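(* Let $\mathbf{k}$ be an infinite field and let $\mathcal{P}=\mathcal{T}(V)/(R)$ be a binary quadratic operad over $\mathbf{k}$ with $V$ finite dimensional. Then $$\mathrm{Tri}(\mathcal{P})^{!}=\mathrm{TSu}(\mathcal{P}^{!})$$ if and only if $R\neq 0$. Here $\mathrm{Tri}$ denotes the triplicator, $\mathrm{TSu}$ the trisuccessor and $(\cdot)^!$ the Koszul dual operad.
   Context: Operads and trees. $\mathcal{P}=\mathcal{T}(V)/(R)$, where $V=V(2)$ is an $\mathbb{S}_2$-module (an $\mathbb{S}$-module concentrated in arity 2), $\mathcal{T}(V)$ is the free symmetric operad on $V$, and $(R)$ is the operadic ideal generated by $R$; $\mathcal{P}$ is quadratic if $R\subseteq\mathcal{T}(V)(3)$. Fix a linear basis $\mathcal{V}$ of $V$ and a choice of one planar representative for each isomorphism class of reduced binary rooted trees, so that $\mathcal{T}(V)$ is identified with $\bigoplus_t t[V]$, the sum being over the chosen planar trees, and has a basis of decorated trees (vertices decorated by elements of $\mathcal{V}$, leaves decorated by distinct positive integers). $R$ is a set of locally homogeneous elements: each $r\in R$ is a combination $r=\sum_i c_i\tau_i$, $c_i\in\mathbf{k}$, of such decorated trees $\tau_i$, all having the same set $\mathrm{Lin}(r)$ of leaf labels. The constructions below are regarded as independent of the choices of basis and planar representatives. In arity 3, $\mathcal{T}(V)(3)$ has the basis $e_i\circ_u e_j$, $u\in\{\mathrm{I},\mathrm{II},\mathrm{III}\}$, where $\{e_i\}$ is a basis of $V$ and $\omega\circ_{\mathrm I}\nu=(x\,\nu\,y)\,\omega\,z$,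 $\omega\circ_{\mathrm{II}}\nu=(y\,\nu\,z)\,\omega\,x$, $\omega\circ_{\mathrm{III}}\nu=(z\,\nu\,x)\,\omega\,y$. Triplicator. $\mathrm{Tri}(V)=V\otimes(\mathbf{k}\dashv\oplus\,\mathbf{k}\vdash\oplus\,\mathbf{k}\perp)$; write $\binom{\omega}{u}=\omega\otimes u$, with $\mathbb{S}_2$-action $\binom{\omega}{\dashv}^{(12)}=\binom{\omega^{(12)}}{\vdash}$, $\binom{\omega}{\vdash}^{(12)}=\binom{\omega^{(12)}}{\dashv}$, $\binom{\omega}{\perp}^{(12)}=\binom{\omega^{(12)}}{\perp}$. For a decorated tree $\tau$ and a nonempty set $J$ of leaves, $\mathrm{Tri}_J(\tau)$ is the set of all decorated trees obtained from $\tau$ by replacing each vertex decoration $\omega$ as follows: if the vertex lies on the path from the root to some $x\in J$, replace $\omega$ by $\binom{\omega}{\dashv}$ if all such paths turn left there, by $\binom{\omega}{\vdash}$ if all such paths turn right there, and by $\binom{\omega}{\perp}$ if some turn left and some turn right; if the vertex lies on no such path, replace $\omega$ by any one of $\binom{\omega}{\dashv},\binom{\omega}{\vdash},\binom{\omega}{\perp}$ (all independent choices). For $r=\sum_i c_i\tau_i$, $\mathrm{Tri}_J(r)=\{\sum_i c_iw_i\mid w_i\in\mathrm{Tri}_J(\tau_i)\}$. Put $\mathrm{Tri}(R)=\bigcup_{r\in R}\bigcup_{\varnothing\ne J\subseteq\mathrm{Lin}(r)}\mathrm{Tri}_J(r)$ and $\mathrm{Tri}(\mathcal{P})=\mathcal{T}(\mathrm{Tri}(V))/(\mathrm{Tri}(R))$.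 Trisuccessor. $\mathrm{TSu}(V)=V\otimes(\mathbf{k}\prec\oplus\,\mathbf{k}\succ\oplus\,\mathbf{k}\,\cdot\,)$ with $\binom{\omega}{\prec}^{(12)}=\binom{\omega^{(12)}}{\succ}$, $\binom{\omega}{\succ}^{(12)}=\binom{\omega^{(12)}}{\prec}$, $\binom{\omega}{\cdot}^{(12)}=\binom{\omega^{(12)}}{\cdot}$. For a decorated tree $\tau$ and a nonempty set $J$ of leaves, $\mathrm{TSu}_J(\tau)\in\mathcal{T}(\mathrm{TSu}(V))$ is obtained by replacing each vertex decoration $\omega$ lying on the path from the root to some $x\in J$ by $\binom{\omega}{\prec}$, $\binom{\omega}{\succ}$ or $\binom{\omega}{\cdot}$ according as all such paths turn left, all turn right, or some turn left and some right at that vertex, and each other $\omega$ by the sum $\binom{\omega}{\prec}+\binom{\omega}{\succ}+\binom{\omega}{\cdot}$; extend linearly. Then $\mathrm{TSu}(\mathcal{P})=\mathcal{T}(\mathrm{TSu}(V))/(\mathrm{TSu}_J(r)\mid r\in R,\ \varnothing\ne J\subseteq\mathrm{Lin}(r))$. Koszul dual. $V^\vee=V^*\otimes\mathrm{sgn}_2$, with the pairing $\langle e_i^\vee\circ_u e_j^\vee,\,e_k\circ_v e_\ell\rangle=\delta_{(i,k)}\delta_{(j,\ell)}\delta_{(u,v)}$ between $\mathcal{T}(V^\vee)(3)$ and $\mathcal{T}(V)(3)$; $R^\perp$ is the annihilator of (the $\mathbb{S}_3$-module generated by) $R$, and $\mathcal{P}^!=\mathcal{T}(V^\vee)/(R^\perp)$.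 The equality is understood under the identification $\mathrm{Tri}(V)^\vee=\mathrm{TSu}(V^\vee)$, with $\binom{e_i^\vee}{\prec},\binom{e_i^\vee}{\succ},\binom{e_i^\vee}{\cdot}$ dual to $\binom{e_i}{\dashv},\binom{e_i}{\vdash},\binom{e_i}{\perp}$ respectively.
   Formalization: V is assumed nonzero (for V = 0 the ''only if'' fails), and Tri(R) collects the relations Tri_J(r) from all bases of V and all choices of planar representatives, since for one fixed basis the construction depends on the choice and the equality can fail. *)

(* Defs.v *)
From HB Require Import structures.
From mathcomp Require Import all_boot all_order all_algebra.
From mathcomp Require Import finmap.
From mathcomp.multinomials Require Import monalg.

Set Implicit Arguments.
Unset Strict Implicit.
Unset Printing Implicit Defensive.

Import GRing.Theory.
Local Open Scope ring_scope.

Definition infinite_field (k : fieldType) : Prop :=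
  forall s : seq k, exists x, x \notin s.

(** * S_2-modules *)

(* A finite dimensional S_2-module; [act v] is v^(12). *)
Record S2Mod (k : fieldType) := MkS2Mod {
  carrier :> vectType k;
  act : carrier -> carrier;
  act_linear : linear act;
  actK : involutive act }.
Arguments act {k s}.

(* The three new labels: [Lft] stands for -| and for "prec", [Rgt] for |- and
   for "succ", [Mid] for perp and for the dot. *)
Inductive slot := Lft | Rgt | Mid.

Definition slot_code (u : slot) : option bool :=
  match u with Lft => Some true | Rgt => Some false | Mid => None end.
Definition slot_decode (b : option bool) : slot :=
  match b with Some true => Lft | Some false => Rgt | None => Mid end.
Lemma slot_codeK : cancel slot_code slot_decode. Proof. by case. Qed.
HB.instance Definition _ := Finite.copy slot (can_type slot_codeK).

Definition slot_swap (u : slot) : slot :=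
  match u with Lft => Rgt | Rgt => Lft | Mid => Mid end.

Section S2Constructions.
Variables (k : fieldType) (V : S2Mod k).

(* V (x) k^3, a vector being given by its three components in V; this is the
   underlying S_2-module of both Tri(V) and TSu(V). *)
Definition split_act (f : {ffun slot -> V}) : {ffun slot -> V} :=
  [ffun u => act (f (slot_swap u))].

Lemma split_act_linear : linear split_act.
Proof. by move=> a f g; apply/ffunP => u; rewrite !ffunE act_linear. Qed.

Lemma split_actK : involutive split_act.
Proof. by move=> f; apply/ffunP => u; rewrite !ffunE actK; case: u. Qed.

Definition splitS2 : S2Mod k := MkS2Mod split_act_linear split_actK.
Definition TriV : S2Mod k := splitS2.
Definition TSuV : S2Mod k := splitS2.

Definition binom (w : V) (u : slot) : splitS2 :=
  [ffun u' => if u' == u then w else 0].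

(* V^* (x) sgn_2, where V^* carries the contragredient action. *)
Definition dual_act (f : 'Hom(V, k^o)) : 'Hom(V, k^o) :=
  - linfun (fun v : V => f (act v)).

Lemma dual_actE f v : dual_act f v = - f (act v).
Proof.
pose g (v : V) : k^o := f (act v).
have gl : linear g by move=> a x y; rewrite /g act_linear linearP.
pose gL : {linear V -> k^o} := HB.pack g (GRing.isLinear.Build _ _ _ _ g gl).
by rewrite /dual_act opp_lfunE (lfunE gL).
Qed.

Lemma dual_act_linear : linear dual_act.
Proof.
move=> a f g; apply/lfunP => v.
by rewrite !(dual_actE, add_lfunE, scale_lfunE) opprD scalerN.
Qed.

Lemma dual_actK : involutive dual_act.
Proof. by move=> f; apply/lfunP => v; rewrite !dual_actE opprK actK. Qed.

Definition dualS2 : S2Mod k := MkS2Mod dual_act_linear dual_actK.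

End S2Constructions.

(* The identification TSu(V^v) = Tri(V)^v: [theta (binom f u)] is the functional
   sending [binom v u'] to f(v) if u = u' and to 0 otherwise. *)
Definition theta (k : fieldType) (V : S2Mod k) (f : TSuV (dualS2 V)) :
    dualS2 (TriV V) :=
  linfun (fun g : TriV V => \sum_(u : slot) (f u : 'Hom(V, k^o)) (g u)).

Section ThetaTheory.
Variables (k : fieldType) (V : S2Mod k).

Lemma thetaE (f : TSuV (dualS2 V)) (g : TriV V) :
  (theta f : 'Hom(TriV V, k^o)) g = \sum_(u : slot) (f u : 'Hom(V, k^o)) (g u).
Proof.
pose h (g : TriV V) : k^o := \sum_(u : slot) (f u : 'Hom(V, k^o)) (g u).
have hl : linear h.
  move=> a x y; rewrite /h scaler_sumr -big_split /=.
  by apply: eq_bigr => u _; rewrite !ffunE linearP.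
pose hL : {linear TriV V -> k^o} := HB.pack h (GRing.isLinear.Build _ _ _ _ h hl).
by rewrite /theta (lfunE hL).
Qed.

Lemma theta_binom (f : dualS2 V) (u : slot) (v : V) (u' : slot) :
  (theta (binom f u) : 'Hom(TriV V, k^o)) (binom v u') =
  if u == u' then (f : 'Hom(V, k^o)) v else 0.
Proof.
rewrite thetaE (bigD1 u) //= big1 ?addr0 => [|w /negPf wu].
  by rewrite !ffunE eqxx; case: eqP => // _; rewrite linear0.
by rewrite ffunE wu lfunE.
Qed.

Lemma theta_linear : linear (@theta k V).
Proof.
move=> a f g; apply/lfunP => x.
rewrite add_lfunE scale_lfunE !thetaE scaler_sumr -big_split /=.
by apply: eq_bigr => u _; rewrite !ffunE add_lfunE scale_lfunE.
Qed.

Lemma theta_act (f : TSuV (dualS2 V)) : theta (act f) = act (theta f).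
Proof.
apply/lfunP => x; rewrite dual_actE !thetaE -sumrN.
have swapK : involutive slot_swap by case.
rewrite [RHS](reindex_inj (inv_inj swapK)) /=; apply: eq_bigr => u _.
by rewrite !ffunE dual_actE swapK.
Qed.

Lemma theta_bij : bijective (@theta k V).
Proof.
pose b (u : slot) (v : V) : TriV V := binom v u.
pose inv (phi : dualS2 (TriV V)) : TSuV (dualS2 V) :=
  [ffun u => linfun (fun v : V => (phi : 'Hom(TriV V, k^o)) (b u v) : k^o)].
have bl u : linear (b u).
  by move=> a x y; apply/ffunP => w; rewrite !ffunE; case: eqP; rewrite ?scaler0 ?addr0.
have invE phi u v : (inv phi u : 'Hom(V, k^o)) v = (phi : 'Hom(TriV V, k^o)) (b u v).
  pose h (v : V) : k^o := (phi : 'Hom(TriV V, k^o)) (b u v).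
  have hl : linear h by move=> a x y; rewrite /h bl linearP.
  pose hL : {linear V -> k^o} := HB.pack h (GRing.isLinear.Build _ _ _ _ h hl).
  by rewrite ffunE (lfunE hL).
exists inv => [f|phi].
  apply/ffunP => u; apply/lfunP => v; rewrite invE thetaE (bigD1 u) //=.
  rewrite big1 ?addr0 => [|w /negPf wu]; first by rewrite ffunE eqxx.
  by rewrite ffunE wu linear0.
apply/lfunP => g; rewrite thetaE (eq_bigr _ (fun u _ => invE phi u (g u))).
rewrite -linear_sum; congr (_ _); apply/ffunP => u; rewrite sum_ffunE.
rewrite (bigD1 u) //= big1 ?addr0 => [|w /negPf wu]; first by rewrite ffunE eqxx.
by rewrite ffunE eq_sym wu.
Qed.

End ThetaTheory.

(** * Planar binary trees, decorated at the vertices and labelled at the leaves *)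

Inductive tree (A : Type) :=
  | Leaf of nat
  | Node of A & tree A & tree A.
Arguments Leaf {A} _.

Section TreeChoice.
Variable A : choiceType.

Fixpoint tree_code (t : tree A) : GenTree.tree (nat + A) :=
  match t with
  | Leaf x => GenTree.Leaf (inl x)
  | Node a l r =>
      GenTree.Node 0 [:: GenTree.Leaf (inr a); tree_code l; tree_code r]
  end.

Fixpoint tree_decode (t : GenTree.tree (nat + A)) : option (tree A) :=
  match t with
  | GenTree.Leaf (inl x) => Some (Leaf x)
  | GenTree.Node _ [:: GenTree.Leaf (inr a); l; r] =>
      match tree_decode l, tree_decode r with
      | Some l', Some r' => Some (Node a l' r')
      | _, _ => None
      end
  | _ => None
  end.

Lemma tree_codeK : pcancel tree_code tree_decode.
Proof. by elim=> //= a l -> r ->. Qed.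

HB.instance Definition _ := Choice.copy (tree A) (pcan_type tree_codeK).
End TreeChoice.

Fixpoint leaves A (t : tree A) : seq nat :=
  match t with Leaf x => [:: x] | Node _ l r => leaves l ++ leaves r end.

Fixpoint decorations A (t : tree A) : seq A :=
  match t with
  | Leaf _ => [::]
  | Node a l r => a :: decorations l ++ decorations r
  end.

Fixpoint map_tree A B (h : A -> B) (s : nat -> nat) (t : tree A) : tree B :=
  match t with
  | Leaf x => Leaf (s x)
  | Node a l r => Node (h a) (map_tree h s l) (map_tree h s r)
  end.

(* Replaces the leaf labelled x of t by t'. *)
Fixpoint graft A (x : nat) (t' t : tree A) : tree A :=
  match t with
  | Leaf y => if y == x then t' else Leaf y
  | Node a l r => Node a (graft x t' l) (graft x t' r)
  end.

Definition shape A (t : tree A) : tree unit := map_tree (fun _ => tt) id t.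

Inductive planar_iso : tree unit -> tree unit -> Prop :=
  | iso_leaf x : planar_iso (Leaf x) (Leaf x)
  | iso_node l r l' r' : planar_iso l l' -> planar_iso r r' ->
      planar_iso (Node tt l r) (Node tt l' r')
  | iso_swap l r l' r' : planar_iso l l' -> planar_iso r r' ->
      planar_iso (Node tt l r) (Node tt r' l').

Definition planar_choice (P : tree unit -> Prop) : Prop :=
  forall s, uniq (leaves s) -> exists! s', planar_iso s s' /\ P s'.

(** * The free operad and its ideals

   T(V)[L], L a finite set of leaf labels, is the quotient of the space spanned
   by the planar trees with set of leaf labels L by multilinearity in the
   decorations and by (v^(12))(l, r) = v(r, l).  An element of T(V) is handled
   through its representatives in the space {malg k[tree V]} of formal linear
   combinations of planar trees; an ideal of T(V) is handled through its inverse
   image in that space. *)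

Section FreeModule.
Variable k : fieldType.

Definition lin_ext (A B : choiceType) (h : A -> {malg k[B]}) (f : {malg k[A]}) :
    {malg k[B]} := \sum_(a <- msupp f) f@_a *: h a.

Definition map_formal (A B : choiceType) (h : A -> B) (s : nat -> nat) :
    {malg k[tree A]} -> {malg k[tree B]} :=
  lin_ext (fun t => << map_tree h s t >>).

Definition relabel (A : choiceType) (s : nat -> nat) :
    {malg k[tree A]} -> {malg k[tree A]} := map_formal id s.

(* The partial composition at the leaf x. *)
Definition comp_at (A : choiceType) (x : nat) (f g : {malg k[tree A]}) :
    {malg k[tree A]} :=
  lin_ext (fun t => lin_ext (fun t' => << graft x t' t >>) g) f.

(* f is locally homogeneous with Lin(f) = L. *)
Definition has_leaves (A : choiceType) (L : seq nat) (f : {malg k[tree A]}) :=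
  uniq L /\ forall t, t \in msupp f -> perm_eq (leaves t) L.

End FreeModule.

Section FreeOperad.
Variables (k : fieldType) (V : S2Mod k).
Local Notation F := {malg k[tree V]}.

Inductive free_relation : F -> Prop :=
  | free_linear a v w l r : uniq (leaves l ++ leaves r) ->
      free_relation
        (<< Node (a *: v + w) l r >> - a *: << Node v l r >> - << Node w l r >>)
  | free_sym v l r : uniq (leaves l ++ leaves r) ->
      free_relation (<< Node (act v) l r >> - << Node v r l >>).

Record operadic_ideal (I : F -> Prop) : Prop := {
  ideal_free f : free_relation f -> I f;
  ideal0 : I 0;
  ideal_lin a f g : I f -> I g -> I (a *: f + g);
  ideal_relabel L s f : has_leaves L f -> {in L &, injective s} ->
    I f -> I (relabel s f);
  ideal_comp L M x f g : has_leaves L f -> has_leaves M g -> x \in L ->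
    (forall y, y \in L -> y \in M -> y = x) ->
    I f \/ I g -> I (comp_at x f g) }.

(* The ideal (R) of T(V). *)
Definition ideal_gen (R : F -> Prop) (f : F) : Prop :=
  forall I, operadic_ideal I -> (forall r, R r -> I r) -> I f.

(* f represents 0 in T(V). *)
Definition free_zero (f : F) : Prop := ideal_gen (fun _ => False) f.

Definition free_eq (f g : F) : Prop := free_zero (f - g).

End FreeOperad.

(* The binary operad T(gens)/(rels). *)
Record binop (k : fieldType) := BinOp {
  gens : S2Mod k;
  rels : {malg k[tree gens]} -> Prop }.

Definition quadratic (k : fieldType) (P : binop k) : Prop :=
  forall r, rels (b := P) r -> has_leaves [:: 1; 2; 3]%N r.

Definition nonzero_rels (k : fieldType) (P : binop k) : Prop :=
  exists r, rels (b := P) r /\ ~ free_zero r.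

(* Equality of T(V)/(R) and T(W)/(S) when V is identified with W along h. *)
Definition operad_eq (k : fieldType) (P Q : binop k) (h : gens P -> gens Q) :=
  forall L f, has_leaves L f ->
    (ideal_gen (rels (b := P)) f <->
     ideal_gen (rels (b := Q)) (map_formal h id f)).

(** * Triplicator and trisuccessor *)

Definition meets A (J : seq nat) (t : tree A) : bool := has (mem J) (leaves t).

(* The direction taken, at a vertex with subtrees l and r, by the paths from the
   root to the leaves in J; [None] if no such path goes through the vertex. *)
Definition turn A (J : seq nat) (l r : tree A) : option slot :=
  match meets J l, meets J r with
  | true, false => Some Lft
  | false, true => Some Rgt
  | true, true => Some Mid
  | false, false => None
  end.

Section Splitting.
Variables (k : fieldType) (V : S2Mod k).

(* [Tri_tree J t w] : w belongs to Tri_J(t). *)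
Inductive Tri_tree (J : seq nat) : tree V -> tree (TriV V) -> Prop :=
  | Tri_leaf x : Tri_tree J (Leaf x) (Leaf x)
  | Tri_node v u l r l' r' :
      turn J l r = Some u \/ turn J l r = None ->
      Tri_tree J l l' -> Tri_tree J r r' ->
      Tri_tree J (Node v l r) (Node (binom v u) l' r').

(* The basis of T(V)[L] attached to a basis e of V and to a choice P of planar
   representatives. *)
Definition basis_tree (e : seq V) (P : tree unit -> Prop) (L : seq nat)
    (t : tree V) : Prop :=
  [/\ perm_eq (leaves t) L, all (mem e) (decorations t) & P (shape t)].

(* w is in Tri_J(r), for r with Lin(r) = L.  The set Tri_J(r) is computed from
   the expansion of r in a basis of decorated trees, and does depend on that
   basis; to have a construction that does not, all the bases of V and all the
   choices of planar representatives are used. *)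
Definition Tri_elt (L J : seq nat) (r : {malg k[tree V]})
    (w : {malg k[tree (TriV V)]}) : Prop :=
  exists (e : seq V) (P : tree unit -> Prop)
         (s : seq (tree V)) (c : tree V -> k) (h : tree V -> tree (TriV V)),
    [/\ basis_of fullv e /\ planar_choice P,
        uniq s /\ (forall t, t \in s -> basis_tree e P L t),
        free_eq r (\sum_(t <- s) c t *: << t >>),
        forall t, t \in s -> Tri_tree J t (h t)
      & w = \sum_(t <- s) c t *: << h t >>].

Fixpoint TSu_tree (J : seq nat) (t : tree V) : tree (TSuV V) :=
  match t with
  | Leaf x => Leaf x
  | Node v l r =>
      Node (if turn J l r is Some u then binom v u
            else binom v Lft + binom v Rgt + binom v Mid)
           (TSu_tree J l) (TSu_tree J r)
  end.

Definition TSu_elt (J : seq nat) : {malg k[tree V]} -> {malg k[tree (TSuV V)]} :=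
  lin_ext (fun t => << TSu_tree J t >>).

End Splitting.

Definition Tri (k : fieldType) (P : binop k) : binop k :=
  @BinOp k (TriV (gens P)) (fun w =>
    exists r L J, [/\ rels (b := P) r, has_leaves L r, J != [::],
                      {subset J <= L} & Tri_elt L J r w]).

Definition TSu (k : fieldType) (P : binop k) : binop k :=
  @BinOp k (TSuV (gens P)) (fun w =>
    exists r L J, [/\ rels (b := P) r, has_leaves L r, J != [::],
                      {subset J <= L} & w = TSu_elt J r]).

(** * Koszul dual *)

Section Koszul.
Variables (k : fieldType) (V : S2Mod k).

(* Writes a tree with leaves 1, 2, 3 as w o_u v, u being recorded by the label
   of the leaf attached to the root: (1 v 2) w 3 is type I, (2 v 3) w 1 is type
   II and (3 v 1) w 2 is type III.  The other planar forms are brought to these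
   by a(l, r) = a^(12)(r, l). *)
Definition cyclic123 (a b c : nat) : bool :=
  [:: a; b; c] \in [:: [:: 1; 2; 3]; [:: 2; 3; 1]; [:: 3; 1; 2]]%N.

Definition orient (w v : V) (a b c : nat) : option (nat * V * V) :=
  if cyclic123 a b c then Some (c, w, v)
  else if cyclic123 b a c then Some (c, w, act v) else None.

Definition normal3 (t : tree V) : option (nat * V * V) :=
  match t with
  | Node w (Node v (Leaf a) (Leaf b)) (Leaf c) => orient w v a b c
  | Node w (Leaf c) (Node v (Leaf a) (Leaf b)) => orient (act w) v a b c
  | _ => None
  end.

(* S_3-submodule generated by R; s permutes {1, 2, 3}. *)
Inductive S3_span (R : {malg k[tree V]} -> Prop) : {malg k[tree V]} -> Prop :=
  | S3_gen r : R r -> S3_span R r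
  | S3_0 : S3_span R 0
  | S3_lin a f g : S3_span R f -> S3_span R g -> S3_span R (a *: f + g)
  | S3_act s f : perm_eq [seq s i | i <- [:: 1; 2; 3]%N] [:: 1; 2; 3]%N ->
      S3_span R f -> S3_span R (relabel s f).

End Koszul.

Section KoszulDual.
Variables (k : fieldType) (V : S2Mod k).

Definition pair_tree (t' : tree (dualS2 V)) (t : tree V) : k :=
  match normal3 t', normal3 t with
  | Some (u', f, g), Some (u, w, v) =>
      if u' == u then (f : 'Hom(V, k^o)) w * (g : 'Hom(V, k^o)) v else 0
  | _, _ => 0
  end.

Definition pairing (f : {malg k[tree (dualS2 V)]}) (g : {malg k[tree V]}) : k :=
  \sum_(t' <- msupp f) \sum_(t <- msupp g) f@_t' * g@_t * pair_tree t' t.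

Definition annihilator (R : {malg k[tree V]} -> Prop)
    (f : {malg k[tree (dualS2 V)]}) : Prop :=
  has_leaves [:: 1; 2; 3]%N f /\ forall r, S3_span R r -> pairing f r = 0.

End KoszulDual.

Definition koszul (k : fieldType) (P : binop k) : binop k :=
  @BinOp k (dualS2 (gens P)) (annihilator (rels (b := P))).

(* Main.v *)
From HB Require Import structures.
Require Import Defs.
From mathcomp Require Import all_boot all_order all_algebra.
From mathcomp Require Import finmap ring.
From mathcomp.multinomials Require Import monalg.
From Stdlib Require Import Classical.

(** A functional on T(U)(3) is a triple of bilinear forms on U, one for each type I, II,
   III; it is well defined on T(U) because it computes products in a nilpotent algebra.
   In these terms the annihilator of Tri(R) contains TSu(R^perp), since the labels
   occurring in Tri_J and TSu_J determine J.  Conversely a form that kills Tri(R) splits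
   into its restrictions to the labels of each Tri_J, which kill R, as soon as it does not
   depend on the label of a vertex lying on no path to J.  Such a vertex exists only for
   J a single leaf attached to the root.  If r in R is not zero and some basis tree of
   this shape has a nonzero coefficient in r, then subtracting two elements of Tri_J(r)
   that differ only at that vertex gives the independence for this basis tree; as k is
   infinite, generic bases give it for all decorations.  If R = 0, nothing in Tri(R)
   forces this independence, and TSu(R^perp) is strictly smaller than everything. *)

Set Implicit Arguments.
Unset Strict Implicit.
Unset Printing Implicit Defensive.

Import GRing.Theory.
Local Open Scope ring_scope.

(** Membership in a generated ideal is proved by congruences modulo an arbitrary operadic ideal
    containing the relations; non-membership requires an explicit ideal, and the identities of an
    algebra provide one. This is why a form on T(U)(3) is turned into a product. The delicate step
    is the passage to all decorations. A set Tri_J(r) is computed from an expansion of r in a basis,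
    and says something about a free label only at basis trees that occur in r. Let A be the matrix
    of the coefficients of r at one type, and B the matrix of the difference of the form between two
    free labels. In the basis given by the columns of M they become M^-1 A M^-T and M^T B M, and the
    comparison shows that the (i, j) entries of the two matrices are never both nonzero. To
    contradict A, B nonzero, one M must make the same entry of both nonzero. It is taken off the
    diagonal as soon as the dimension exceeds 1: if B is alternating, its diagonal vanishes in every
    basis. *)

(* [lift] and, below, [tb] are sealed: conversion tests that unfold them do not
   terminate in reasonable time. *)
HB.lock Definition lift (k : fieldType) (A : choiceType) (M : lmodType k)
    (phi : A -> M) (f : {malg k[A]}) : M :=
  \sum_(a <- msupp f) f@_a *: phi a.

(** * Linear extension of maps to formal combinations *)

Section LinearExtension.
Variables (k : fieldType) (A : choiceType).
Implicit Types (f g : {malg k[A]}).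

Lemma msupp_basis a : msupp (<< a >> : {malg k[A]}) = [fset a]%fset.
Proof. by rewrite msuppU oner_eq0. Qed.

Section Lift.
Variables (M : lmodType k) (phi : A -> M).

Lemma lift_fset (d : {fset A}) f : (msupp f `<=` d)%fset ->
  lift phi f = \sum_(a <- d) f@_a *: phi a.
Proof.
move=> le_d; rewrite lift.unlock (big_fset_incl _ le_d) //= => a _ /mcoeff_outdom ->.
by rewrite scale0r.
Qed.

Lemma lift_linear : linear (lift phi).
Proof.
move=> c f g; pose d := (msupp f `|` msupp g `|` msupp (c *: f + g))%fset.
rewrite !(@lift_fset d); do 1?by apply/fsubsetP => a; rewrite !inE => ->; rewrite ?orbT.
rewrite scaler_sumr -big_split /=; apply: eq_bigr => a _.
by rewrite mcoeffD mcoeffZ scalerDl scalerA.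
Qed.

HB.instance Definition _ :=
  GRing.isLinear.Build k {malg k[A]} M _ (lift phi) lift_linear.

Lemma liftU a : lift phi << a >> = phi a.
Proof. by rewrite lift.unlock msupp_basis big_seq_fset1 mcoeffUU scale1r. Qed.

Lemma lift0 : lift phi 0 = 0. Proof. exact: linear0. Qed.

Lemma liftZ c f : lift phi (c *: f) = c *: lift phi f. Proof. exact: linearZ. Qed.

Lemma liftD f g : lift phi (f + g) = lift phi f + lift phi g.
Proof. exact: linearD. Qed.

Lemma liftB f g : lift phi (f - g) = lift phi f - lift phi g.
Proof. exact: linearB. Qed.

Lemma lift_eq (psi : A -> M) f :
  {in msupp f, phi =1 psi} -> lift phi f = lift psi f.
Proof.
by move=> eq_f; rewrite lift.unlock big_seq [RHS]big_seq; apply: eq_bigr => a /eq_f ->.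
Qed.

Lemma lift_sum (I : Type) (s : seq I) (c : I -> k) (t : I -> A) :
  lift phi (\sum_(i <- s) c i *: << t i >>) = \sum_(i <- s) c i *: phi (t i).
Proof. by rewrite linear_sum; apply: eq_bigr => i _; rewrite linearZ /= liftU. Qed.
End Lift.

Lemma malg_expand f : f = \sum_(a <- msupp f) f@_a *: << a >>.
Proof.
rewrite {1}[f]monalgE; apply: eq_bigr => a _; apply/malgP => b.
by rewrite mcoeffZ !mcoeffU; case: (a == b); rewrite ?mulr1n ?mulr0n ?mulr1 ?mulr0.
Qed.

Lemma linear_lift (M N : lmodType k) (h : {linear M -> N}) (phi : A -> M) f :
  h (lift phi f) = lift (h \o phi) f.
Proof. by rewrite lift.unlock linear_sum; apply: eq_bigr => a _; rewrite linearZ. Qed.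

Lemma lift_comp (M N : lmodType k) (h : M -> N) (phi : A -> M) f :
  linear h -> h (lift phi f) = lift (h \o phi) f.
Proof.
move=> hl; pose hL : {linear M -> N} := HB.pack h (GRing.isLinear.Build _ _ _ _ h hl).
exact: (linear_lift hL).
Qed.

Lemma lift_sumr (M : lmodType k) (I : Type) (s : seq I) (c : I -> k)
    (phi : I -> A -> M) f :
  lift (fun a => \sum_(i <- s) c i *: phi i a) f = \sum_(i <- s) c i *: lift (phi i) f.
Proof.
rewrite lift.unlock; under eq_bigr do rewrite scaler_sumr.
rewrite exchange_big; apply: eq_bigr => i _; rewrite scaler_sumr; apply: eq_bigr => a _.
by rewrite !scalerA mulrC.
Qed.

Lemma lift_in (Q : {malg k[A]} -> Prop) f : Q 0 ->
  (forall c g h, Q g -> Q h -> Q (c *: g + h)) ->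
  (forall a, a \in msupp f -> Q << a >>) -> Q f.
Proof.
move=> Q0 Qlin Qf; rewrite [f]malg_expand big_seq.
by elim/big_rec: _ => // a g /Qf; apply: Qlin.
Qed.
End LinearExtension.

Section LinExt.
Variables (k : fieldType) (A B : choiceType).

Lemma lin_extE (h : A -> {malg k[B]}) : lin_ext h =1 lift h.
Proof. by move=> f; rewrite lift.unlock. Qed.

Lemma lift_lin_ext (M : lmodType k) (phi : B -> M) (h : A -> {malg k[B]}) f :
  lift phi (lin_ext h f) = lift (fun a => lift phi (h a)) f.
Proof. by rewrite lin_extE (linear_lift (lift phi)). Qed.

Lemma lift_map (M : lmodType k) (phi : B -> M) (h : A -> B) (f : {malg k[A]}) :
  lift phi (lin_ext (fun a => << h a >>) f) = lift (phi \o h) f.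
Proof. by rewrite lift_lin_ext; apply: lift_eq => a _; rewrite liftU. Qed.

Lemma lin_ext_linear (h : A -> {malg k[B]}) : linear (lin_ext h).
Proof. by move=> c f g; rewrite !lin_extE lift_linear. Qed.

Lemma lin_extU (h : A -> {malg k[B]}) a : lin_ext h << a >> = h a.
Proof. by rewrite lin_extE liftU. Qed.

Lemma msupp_lin_ext (h : A -> {malg k[B]}) f b : b \in msupp (lin_ext h f) ->
  exists2 a, a \in msupp f & b \in msupp (h a).
Proof.
rewrite /lin_ext big_seq; elim/big_rec: _ => [|a g af IH]; first by rewrite msupp0.
move/(fsubsetP (msuppD_le _ _)); rewrite inE => /orP[|/IH//].
by move/(fsubsetP (msuppZ_le _ _)); exists a.
Qed.
End LinExt.

(** * Relabelling and redecorating formal combinations; their leaf sets *)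

Section Maps.
Variables (k : fieldType).

Lemma map_treeK (A B C : Type) (h : A -> B) (h' : B -> C) s s' t :
  map_tree h' s' (map_tree h s t) = map_tree (h' \o h) (s' \o s) t.
Proof. by elim: t => //= a l -> r ->. Qed.

Lemma eq_map_tree (A B : Type) (h h' : A -> B) s s' t :
  h =1 h' -> s =1 s' -> map_tree h s t = map_tree h' s' t.
Proof. by move=> eh es; elim: t => /= [x|a l -> r ->]; rewrite ?eh ?es. Qed.

Lemma map_tree_id (A : Type) (t : tree A) : map_tree id id t = t.
Proof. by elim: t => //= a l -> r ->. Qed.

Lemma leaves_map (A B : Type) (h : A -> B) s t :
  leaves (map_tree h s t) = map s (leaves t).
Proof. by elim: t => //= a l -> r ->; rewrite map_cat. Qed.

Lemma map_formal_comp (A B C : choiceType) (h : A -> B) (h' : B -> C) s s'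
    (f : {malg k[tree A]}) :
  map_formal h' s' (map_formal h s f) = map_formal (h' \o h) (s' \o s) f.
Proof.
rewrite /map_formal lin_extE lift_map -lin_extE; apply: eq_bigr => t _ /=.
by rewrite map_treeK.
Qed.

Lemma eq_map_formal (A B : choiceType) (h h' : A -> B) s s'
    (f : {malg k[tree A]}) :
  h =1 h' -> s =1 s' -> map_formal h s f = map_formal h' s' f.
Proof. by move=> eh es; apply: eq_bigr => t _; rewrite (eq_map_tree _ eh es). Qed.

Lemma map_formal_id (A : choiceType) (f : {malg k[tree A]}) :
  map_formal id id f = f.
Proof.
rewrite [RHS]malg_expand; apply: eq_bigr => t _.
by rewrite map_tree_id.
Qed.

Section MapFormalLinear.
Variables (A B : choiceType) (h : A -> B) (s : nat -> nat).

Lemma map_formal_linear : linear (map_formal h s : {malg k[tree A]} -> _).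
Proof. exact: lin_ext_linear. Qed.

Lemma map_formal0 : map_formal h s 0 = 0 :> {malg k[tree B]}.
Proof. by rewrite /map_formal lin_extE lift0. Qed.

Lemma map_formalB (f g : {malg k[tree A]}) :
  map_formal h s (f - g) = map_formal h s f - map_formal h s g.
Proof. by rewrite /map_formal !lin_extE liftB. Qed.

Lemma map_formalZ c (f : {malg k[tree A]}) :
  map_formal h s (c *: f) = c *: (map_formal h s f) :> {malg k[tree B]}.
Proof. by rewrite /map_formal !lin_extE liftZ. Qed.

Lemma map_formalU t : map_formal h s << t >> = << map_tree h s t >> :> {malg k[tree B]}.
Proof. by rewrite /map_formal lin_extU. Qed.

Lemma lift_map_formal (M : lmodType k) (phi : tree B -> M) (f : {malg k[tree A]}) :
  lift phi (map_formal h s f) = lift (phi \o map_tree h s) f.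
Proof. exact: lift_map. Qed.
End MapFormalLinear.

Lemma has_leaves_lin_ext (A B : choiceType) L M (h : tree A -> {malg k[tree B]})
    (f : {malg k[tree A]}) : has_leaves L f -> uniq M ->
  (forall t, t \in msupp f -> perm_eq (leaves t) L -> has_leaves M (h t)) ->
  has_leaves M (lin_ext h f).
Proof.
move=> [_ fL] uM hM; split=> // t /msupp_lin_ext[a af].
by case: (hM a af (fL _ af)) => _; apply.
Qed.

Lemma has_leavesU (A : choiceType) (t : tree A) L :
  uniq L -> perm_eq (leaves t) L -> has_leaves L (<< t >> : {malg k[tree A]}).
Proof. by move=> uL tL; split=> // t'; rewrite msupp_basis inE => /eqP->. Qed.

Lemma has_leaves0 (A : choiceType) L : uniq L -> has_leaves L (0 : {malg k[tree A]}).
Proof. by split=> // t; rewrite msupp0. Qed.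

Lemma has_leaves_lin (A : choiceType) L (c : k) (f g : {malg k[tree A]}) :
  has_leaves L f -> has_leaves L g -> has_leaves L (c *: f + g).
Proof.
move=> [uL fL] [_ gL]; split=> // t /(fsubsetP (msuppD_le _ _)).
by rewrite inE => /orP[/(fsubsetP (msuppZ_le _ _))/fL|/gL].
Qed.

Lemma has_leavesZ (A : choiceType) L (c : k) (f : {malg k[tree A]}) :
  has_leaves L f -> has_leaves L (c *: f).
Proof.
by move=> fL; rewrite -[c *: f]addr0; apply: has_leaves_lin (has_leaves0 _ _) => //; case: fL.
Qed.

Lemma has_leaves_sum (A : choiceType) L (J : Type) (s : seq J) (f : J -> {malg k[tree A]}) :
  uniq L -> (forall j, has_leaves L (f j)) -> has_leaves L (\sum_(j <- s) f j).
Proof.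
move=> uL fL; elim/big_rec: _ => [|j g _ Lg]; first exact: has_leaves0.
by rewrite -[f j]scale1r; apply: has_leaves_lin.
Qed.

Lemma has_leavesB (A : choiceType) L (f g : {malg k[tree A]}) :
  has_leaves L f -> has_leaves L g -> has_leaves L (f - g).
Proof. by move=> fL gL; rewrite addrC -scaleN1r; apply: has_leaves_lin. Qed.

Lemma has_leaves_map (A B : choiceType) (h : A -> B) s L (f : {malg k[tree A]}) :
  {in L &, injective s} -> has_leaves L f -> has_leaves (map s L) (map_formal h s f).
Proof.
move=> s_inj fL; have [uL _] := fL.
have usL : uniq (map s L) by rewrite map_inj_in_uniq.
apply: (has_leaves_lin_ext fL usL) => t _ tL.
by apply: has_leavesU => //; rewrite leaves_map perm_map.
Qed.

Lemma has_leaves_map_id (A B : choiceType) (h : A -> B) L (f : {malg k[tree A]}) :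
  has_leaves L f -> has_leaves L (map_formal h id f).
Proof. by move=> fL; rewrite -[L]map_id; apply: has_leaves_map. Qed.

Lemma has_leaves_perm (A : choiceType) L M (f : {malg k[tree A]}) :
  perm_eq L M -> has_leaves L f -> has_leaves M f.
Proof.
move=> LM [uL fL]; split; first by rewrite -(perm_uniq LM).
by move=> t /fL tL; apply: perm_trans tL LM.
Qed.

Lemma has_leaves_perm_eq (A : choiceType) L M (f : {malg k[tree A]}) :
  has_leaves L f -> has_leaves M f -> f != 0 -> perm_eq L M.
Proof.
move=> [_ fL] [_ fM]; have [f0|/fset0Pn[t tf] _] := eqVneq (msupp f) fset0.
  by rewrite [f]malg_expand f0 big_seq_fset0 eqxx.
by apply: perm_trans (fM _ tf); rewrite perm_sym fL.
Qed.
End Maps.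

Lemma map_tree_graft (A B : Type) (h : A -> B) x t' t :
  map_tree h id (graft x t' t) = graft x (map_tree h id t') (map_tree h id t).
Proof. by elim: t => /= [y|a l -> r ->] //; case: eqP. Qed.

HB.lock Definition tb (k : fieldType) (U : S2Mod k) (t : tree U) : {malg k[tree U]} :=
  << t >>.

(** * Algebras over the free operad and their identities *)

Section FreeRelations.
Variables (k : fieldType) (U : S2Mod k).

Local Notation node := (@Node (Vector.sort (carrier U))).

Lemma free_linear_tb a (v w : U) l r : uniq (leaves l ++ leaves r) ->
  free_relation (tb (node (a *: v + w) l r) - a *: tb (node v l r) - tb (node w l r)).
Proof. by rewrite tb.unlock; apply: free_linear. Qed.

Lemma free_sym_tb (v : U) l r : uniq (leaves l ++ leaves r) ->
  free_relation (tb (node (act v) l r) - tb (node v r l)).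
Proof. by rewrite tb.unlock; apply: free_sym. Qed.

Lemma free_relationP (Q : {malg k[tree U]} -> Prop) :
  (forall a (v w : U) l r, uniq (leaves l ++ leaves r) ->
    Q (tb (node (a *: v + w) l r) - a *: tb (node v l r) - tb (node w l r))) ->
  (forall (v : U) l r, uniq (leaves l ++ leaves r) ->
    Q (tb (node (act v) l r) - tb (node v r l))) ->
  forall f, free_relation f -> Q f.
Proof. by rewrite tb.unlock; move=> Q1 Q2 f [a v w l r u|v l r u]; [apply: Q1 u|apply: Q2 u]. Qed.

Lemma lift_tb (M : lmodType k) (phi : tree U -> M) t : lift phi (tb t) = phi t.
Proof. by rewrite tb.unlock liftU. Qed.
End FreeRelations.

Section Evaluation.
Variables (k : fieldType) (U : S2Mod k) (A : lmodType k) (mul : U -> A -> A -> A).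
Hypothesis mul_dec : forall a b, linear (fun v => mul v a b).
Hypothesis mul_l : forall v b, linear (fun a => mul v a b).
Hypothesis mul_sym : forall v a b, mul (act v) a b = mul v b a.

(** The hypotheses on [mul] make [A] an algebra over the free operad on [U]; a tree acts as an
    operation, its inputs being listed by [env]. *)
Fixpoint eval (env : nat -> A) (t : tree U) : A :=
  match t with
  | Leaf x => env x
  | Node v l r => mul v (eval env l) (eval env r)
  end.

Let mul_r v a : linear (fun b => mul v a b).
Proof. by move=> c b b'; rewrite -!(mul_sym v) mul_l. Qed.

Definition upd (env : nat -> A) x a := fun y => if y == x then a else env y.

Lemma eval_upd_notin env x a t : x \notin leaves t -> eval (upd env x a) t = eval env t.
Proof.
elim: t => /= [y|v l IHl r IHr]; first by rewrite inE /upd eq_sym => /negPf->.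
by rewrite mem_cat negb_or => /andP[/IHl-> /IHr->].
Qed.

(** Distinct leaf labels put [x] in exactly one of the two subtrees at each vertex; the other one
    does not see the update. *)
Lemma eval_upd_linear env x t :
  uniq (leaves t) -> x \in leaves t -> linear (fun a => eval (upd env x a) t).
Proof.
move=> ut xt c a b; elim: t ut xt => /= [y _|v l IHl r IHr].
  by rewrite inE /upd => /eqP->; rewrite eqxx.
rewrite cat_uniq mem_cat => /and3P[ul /hasPn lr ur].
case xr: (x \in leaves r) => /=; rewrite (orbT, orbF) => xl.
  by rewrite !(@eval_upd_notin _ _ _ l) ?IHr ?mul_r //; apply: lr.
by rewrite !(@eval_upd_notin _ _ _ r) ?xr // IHl // mul_l.
Qed.

Lemma eval_graft env x t' t : eval env (graft x t' t) = eval (upd env x (eval env t')) t.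
Proof. by elim: t => /= [y|v l -> r -> //]; rewrite /upd; case: eqP. Qed.

Lemma eval_relabel env s t : eval env (map_tree id s t) = eval (env \o s) t.
Proof. by elim: t => //= v l -> r ->. Qed.

Lemma eval_comp_at L x f g env : has_leaves L f -> x \in L ->
  lift (eval env) (comp_at x f g) = lift (eval (upd env x (lift (eval env) g))) f.
Proof.
move=> [uL fL] xL; rewrite /comp_at lift_lin_ext; apply: lift_eq => t tf.
have ut : uniq (leaves t) by rewrite (perm_uniq (fL t tf)).
have xt : x \in leaves t by rewrite (perm_mem (fL t tf)).
pose e a := eval (upd env x a) t.
pose eL : {linear A -> A} :=
  HB.pack e (GRing.isLinear.Build _ _ _ _ e (eval_upd_linear env ut xt)).
rewrite lift_map -[RHS]/(eL _) linear_lift; apply: lift_eq => t' _ /=.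
by rewrite eval_graft.
Qed.

(** The identities of an algebra are stable under operadic composition: grafting g at the leaf x
    amounts to evaluating f with x sent to the value of g. If g is an identity, each tree of f
    vanishes by linearity in that leaf. *)
Lemma eval_kernel_ideal :
  operadic_ideal (fun f : {malg k[tree U]} => forall env, lift (eval env) f = 0).
Proof.
split=> [|env|c f g f0 g0 env|L s f _ _ f0 env|L M x f g fL gM xL _ fg0 env].
- apply: free_relationP => [a v w|v] l r _ env.
    rewrite 2!liftB liftZ 3!lift_tb /= mul_dec.
    by rewrite -addrA -opprD subrr.
  by rewrite liftB 2!lift_tb /= mul_sym subrr.
- exact: lift0.
- by rewrite liftD liftZ f0 g0 scaler0 addr0.
- rewrite /relabel /map_formal lift_map -(f0 (env \o s)).
  by apply: lift_eq => t _; rewrite /= eval_relabel.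
- rewrite (eval_comp_at _ _ fL xL); case: fg0 => [-> //|->].
  rewrite lift.unlock big_seq big1 // => t tf; case: fL => uL /(_ t tf) tL.
  have ut : uniq (leaves t) by rewrite (perm_uniq tL).
  have xt : x \in leaves t by rewrite (perm_mem tL).
  (* Linearity at [1 *: 0 + 0] reads E = E + E, so the tree vanishes when its leaf [x] is sent to
     0. *)
  have /eqP := eval_upd_linear env ut xt 1 0 0.
  by rewrite !scale1r addr0 -subr_eq0 opprD addNKr oppr_eq0 => /eqP->; rewrite scaler0.
Qed.

End Evaluation.

(** * Planar forms of the trees with leaves 1, 2, 3 *)

Notation S3 := [:: 1; 2; 3]%N.

Definition nxt (u : nat) : nat := match u with 1 => 2 | 2 => 3 | _ => 1 end.

Definition perm3 (s : nat -> nat) := perm_eq [seq s i | i <- S3] S3.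

Lemma S3P u : u \in S3 -> [\/ u = 1, u = 2 | u = 3]%N.
Proof. by rewrite !inE => /or3P[]/eqP->;
  first [by constructor 1|by constructor 2|by constructor 3]. Qed.

Lemma perm3P s : perm3 s ->
  [\/ (s 1, s 2, s 3) = (1, 2, 3), (s 1, s 2, s 3) = (2, 3, 1),
      (s 1, s 2, s 3) = (3, 1, 2) |
   [\/ (s 1, s 2, s 3) = (2, 1, 3), (s 1, s 2, s 3) = (3, 2, 1) |
      (s 1, s 2, s 3) = (1, 3, 2)]]%N.
Proof.
rewrite /perm3 /= => p; have := perm_mem p; have := perm_uniq p.
move: (s 1%N) (s 2%N) (s 3%N) => a b c /=.
rewrite !inE => + m; have := m a; have := m b; have := m c.
rewrite !inE !eqxx !orbT /=.
move=> /esym/or3P[]/eqP-> /esym/or3P[]/eqP-> /esym/or3P[]/eqP-> //= _;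
first [by constructor 1|by constructor 2|by constructor 3|constructor 4];
first [by constructor 1|by constructor 2|by constructor 3].
Qed.

(** The four planar forms of the tree whose root carries the leaf [u]: [b] and [b'] tell whether the
    root and the inner vertex are reversed with respect to the cyclic orientation chosen in
    [normal3]. *)
Definition std (X : Type) (u : nat) (b b' : bool) (w v : X) : tree X :=
  let inner := if b' then Node v (Leaf (nxt (nxt u))) (Leaf (nxt u))
               else Node v (Leaf (nxt u)) (Leaf (nxt (nxt u))) in
  if b then Node w (Leaf u) inner else Node w inner (Leaf u).

Lemma leaves_std X u b b' (w v : X) : u \in S3 -> perm_eq (leaves (std u b b' w v)) S3.
Proof. by case/S3P=> ->; case: b; case: b'. Qed.

Lemma stdP X (t : tree X) : perm_eq (leaves t) S3 ->
  exists u b b' w v, u \in S3 /\ t = std u b b' w v.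
Proof.
have leaf0 (t' : tree X) : (0 < size (leaves t'))%N.
  by elim: t' => //= a l IHl r IHr; rewrite size_cat addn_gt0 IHl.
have leaf1 (t' : tree X) : size (leaves t') = 1%N -> exists x, t' = Leaf x.
  case: t' => /= [x|a l r]; first by exists x.
  have := leaf0 l; have := leaf0 r; rewrite size_cat.
  by case: size => // m; case: size => // n; rewrite addnS.
have leaf2 (t' : tree X) : size (leaves t') = 2%N ->
    exists a x y, t' = Node a (Leaf x) (Leaf y).
  case: t' => //= a l r; have := leaf0 l; have := leaf0 r; rewrite size_cat.
  case sl: (size (leaves l)) => [|[|[|n]]] //; case sr: (size (leaves r)) => [|[|m]] // _ _ _.
  by have [x ->] := leaf1 _ sl; have [y ->] := leaf1 _ sr; exists a, x, y.
have three a b c : perm_eq [:: a; b; c] S3 ->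
    c \in S3 /\ exists b', [:: a; b] =
      if b' then [:: nxt (nxt c); nxt c] else [:: nxt c; nxt (nxt c)].
  move=> p; have := perm_mem p; have := perm_uniq p; rewrite /= !inE => + m.
  have := m a; have := m b; have := m c; rewrite !inE !eqxx !orbT /=.
  by move=> /esym/or3P[]/eqP-> /esym/or3P[]/eqP-> /esym/or3P[]/eqP-> //= _;
    split=> //; first [by exists true | by exists false].
case: t => [x /perm_size //|w l r] p; have := perm_size p; rewrite /= size_cat => ps.
have := leaf0 l; have := leaf0 r.
case sl: (size (leaves l)) ps => [|[|[|n]]]; case sr: (size (leaves r)) => [|[|[|m]]] //;
  rewrite ?addnS ?addn0 => // _ _ _.
  have [c El] := leaf1 _ sl; have [v [a [b Er]]] := leaf2 _ sr.
  move: p; rewrite {}El {}Er /= -[[:: c; a; b]]/([:: c] ++ [:: a; b]) perm_catC.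
  move=> /three[cS [b' E]].
  by exists c, true, b', w, v; split=> //; case: b' E => [[-> ->]|[-> ->]].
have [c Er] := leaf1 _ sr; have [v [a [b El]]] := leaf2 _ sl.
move: p; rewrite {}El {}Er /= => /three[cS [b' E]].
by exists c, false, b', w, v; split=> //; case: b' E => [[-> ->]|[-> ->]].
Qed.

(** For a permutation of 1, 2, 3 this is oddness: the even ones are the rotations, which preserve
    the cyclic order given by [nxt], and the odd ones reverse it, hence reverse the inner vertex. *)
Definition orev (s : nat -> nat) : bool := s 2%N != nxt (s 1%N).

Lemma perm3_in s u : perm3 s -> u \in S3 -> s u \in S3.
Proof. by move=> p uS; rewrite -(perm_mem p) map_f. Qed.

Lemma map_std X Y (h : X -> Y) s u b b' w v : perm3 s -> u \in S3 ->
  map_tree h s (std u b b' w v) = std (s u) b (b' (+) orev s) (h w) (h v).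
Proof.
rewrite /orev => /perm3P[|||[||]] [e1 e2 e3] /S3P[]->.
all: by rewrite /std; case: b; case: b'; rewrite /= ?e1 ?e2 ?e3.
Qed.

Lemma map_std_id X Y (h : X -> Y) u b b' w v :
  map_tree h id (std u b b' w v) = std u b b' (h w) (h v).
Proof. by rewrite /std; case: b; case: b'. Qed.

Lemma perm3_id : perm3 id. Proof. by []. Qed.

Lemma perm3_comp s s' : perm3 s -> perm3 s' -> perm3 (s \o s').
Proof.
move=> p p'; rewrite /perm3 map_comp.
by apply: (@perm_trans _ [seq s i | i <- S3]) p; apply: (perm_map s p').
Qed.

Lemma perm3_inj s : perm3 s -> {in S3 &, injective s}.
Proof.
by move=> /perm3P[|||[||]] [e1 e2 e3] x y /S3P[]-> /S3P[]->; rewrite ?e1 ?e2 ?e3.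
Qed.

(** * Triples of bilinear forms as functionals on T(U)(3) *)

Section Pairs.
Variables (k : fieldType) (M N P : lmodType k).

Lemma fst_lin (c : k) (a b : M * N) : (c *: a + b).1 = c *: a.1 + b.1.
Proof. by []. Qed.

Lemma snd_lin (c : k) (a b : M * N) : (c *: a + b).2 = c *: a.2 + b.2.
Proof. by []. Qed.

Lemma triple_lin (c : k) (a a' : M) (b b' : N) (d d' : P) :
  c *: (a, b, d) + (a', b', d') = (c *: a + a', c *: b + b', c *: d + d').
Proof. by []. Qed.
End Pairs.

Definition slot_of (x : nat) : slot :=
  match x with 1 => Lft | 2 => Rgt | _ => Mid end.

Definition snext (i : slot) : slot :=
  match i with Lft => Rgt | Rgt => Mid | Mid => Lft end.

Definition map123 (q : nat * nat * nat) (x : nat) : nat :=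
  match x with 1 => q.1.1 | 2 => q.1.2 | _ => q.2 end.

Definition perms3 : seq (nat * nat * nat) :=
  [:: (1, 2, 3); (2, 3, 1); (3, 1, 2); (2, 1, 3); (3, 2, 1); (1, 3, 2)]%N.

Lemma perms3P q : q \in perms3 -> perm3 (map123 q).
Proof. by apply: (allP (_ : all (fun q => perm_eq (map (map123 q) S3) S3) perms3)). Qed.

Section Forms.
Variables (k : fieldType) (U : S2Mod k).
Implicit Types (Phi : nat -> U -> U -> k^o) (t : tree U) (f : {malg k[tree U]}).

Definition bilinear_form Phi : Prop :=
  (forall u v, linear (fun w => Phi u w v)) /\ (forall u w, linear (Phi u w)).

Definition twist (b : bool) (w : U) : U := if b then act w else w.

Lemma normal3_std u b b' (w v : U) : u \in S3 ->
  normal3 (std u b b' w v) = Some (u, twist b w, twist b' v).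
Proof. by case/S3P=> ->; case: b; case: b'. Qed.

Lemma normal3_size t : normal3 t -> size (leaves t) = 3%N.
Proof.
by case: t => // w [x|v [a|? ? ?] [b|? ? ?]] [y|v' [c|? ? ?] [d|? ? ?]].
Qed.

Definition evt Phi t : k^o := if normal3 t is Some (u, w, v) then Phi u w v else 0.

Definition ev Phi f : k^o := lift (evt Phi) f.

Lemma evt_std Phi u b b' w v : u \in S3 ->
  evt Phi (std u b b' w v) = Phi u (twist b w) (twist b' v).
Proof. by move=> uS; rewrite /evt normal3_std. Qed.

Lemma eq_ev Phi Psi f : {in msupp f, evt Phi =1 evt Psi} -> ev Phi f = ev Psi f.
Proof. exact: lift_eq. Qed.

Lemma ev_relabel Phi s f : ev Phi (relabel s f) = lift (fun t => evt Phi (map_tree id s t)) f.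
Proof. by rewrite /ev /relabel /map_formal lift_map. Qed.

(* A nilpotent algebra with components [w1], [w2], [w3] of weights 1, 2, 3:
   [w1] is spanned by x_1, x_2, x_3, the component [w2] by the products v(x_i, x_j),
   one copy of [U] for each pair, and weight 3 is the ground field, [Phi] giving
   the product of weights 2 and 1.  The pair {i, j} is recorded by the remaining
   index, and the indices 1, 2, 3 are encoded by [slot_of]. *)
Section Nilpotent.
Variable Phi : nat -> U -> U -> k^o.
Hypothesis Phi_bilin : bilinear_form Phi.

Definition nilp : lmodType k :=
  ({ffun slot -> k^o} * {ffun slot -> U} * k^o)%type.

Definition w1 (a : nilp) (i : slot) : k^o := a.1.1 i.
Definition w2 (a : nilp) (i : slot) : U := a.1.2 i.
Definition w3 (a : nilp) : k^o := a.2.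

Definition nmul0 (v : U) (a b : nilp) : nilp :=
  (0,
   [ffun i => (match i with
               | Lft => w1 a Rgt * w1 b Mid
               | Rgt => w1 a Mid * w1 b Lft
               | Mid => w1 a Lft * w1 b Rgt
               end : k^o) *: v],
   Phi 1 v (w2 a Lft) * w1 b Lft + Phi 2 v (w2 a Rgt) * w1 b Rgt
     + Phi 3 v (w2 a Mid) * w1 b Mid).

(** [nmul0] multiplies only in the cyclic order, the factor of weight 2 coming before that of weight
    1. As [act] is an involution, adding the exchanged term forces [nmul_sym]. *)
Definition nmul v a b : nilp := nmul0 v a b + nmul0 (act v) b a.

Arguments nmul : simpl never.
Arguments w1 : simpl never.
Arguments w2 : simpl never.
Arguments w3 : simpl never.

Lemma w1_linear i : linear (w1 ^~ i).
Proof. by move=> c a b; rewrite /w1 !fst_lin !ffunE. Qed.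
Lemma w2_linear i : linear (w2 ^~ i).
Proof. by move=> c a b; rewrite /w2 fst_lin snd_lin !ffunE. Qed.
Lemma w3_linear : linear w3.
Proof. by move=> c a b; rewrite /w3 snd_lin. Qed.

Lemma nmul0_dec a b : linear (fun v => nmul0 v a b).
Proof.
move=> c v v'; rewrite /nmul0 !Phi_bilin.1 triple_lin.
congr (_, _, _); first by rewrite scaler0 addr0.
  by apply/ffunP => i; rewrite !ffunE scalerDr !scalerA mulrC.
by rewrite /GRing.scale /=; ring.
Qed.

Lemma nmul0_l v b : linear (fun a => nmul0 v a b).
Proof.
move=> c a a'; rewrite /nmul0 !w1_linear !w2_linear !Phi_bilin.2 triple_lin.
congr (_, _, _); first by rewrite scaler0 addr0.
  apply/ffunP => i; rewrite !ffunE scalerA -scalerDl; congr (_ *: _).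
  by case: i; rewrite mulrDl -scalerAl.
by rewrite /GRing.scale /=; ring.
Qed.

Lemma nmul0_r v a : linear (fun b => nmul0 v a b).
Proof.
move=> c b b'; rewrite /nmul0 !w1_linear triple_lin.
congr (_, _, _); first by rewrite scaler0 addr0.
  apply/ffunP => i; rewrite !ffunE scalerA -scalerDl; congr (_ *: _).
  by case: i; rewrite mulrDr -scalerAr.
by rewrite /GRing.scale /=; ring.
Qed.

Lemma nmul_dec a b : linear (fun v => nmul v a b).
Proof.
move=> c v v'; rewrite /nmul act_linear !nmul0_dec scalerDr -!addrA.
by congr (_ + _); rewrite addrCA.
Qed.

Lemma nmul_l v b : linear (fun a => nmul v a b).
Proof.
move=> c a a'; rewrite /nmul nmul0_l nmul0_r scalerDr -!addrA.
by congr (_ + _); rewrite addrCA.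
Qed.

Lemma nmul_sym v a b : nmul (act v) a b = nmul v b a.
Proof. by rewrite /nmul actK addrC. Qed.

Lemma w1_nmul v a b i : w1 (nmul v a b) i = 0.
Proof.
rewrite /nmul -[nmul0 v a b]scale1r w1_linear scale1r /w1 /=.
by rewrite !ffunE addr0.
Qed.

Lemma w2_nmul v a b i : w2 (nmul v a b) i =
  w1 a (snext i) * w1 b (snext (snext i)) *: v +
  w1 b (snext i) * w1 a (snext (snext i)) *: act v.
Proof.
rewrite /nmul -[nmul0 v a b]scale1r w2_linear scale1r /w2 !ffunE.
by case: i.
Qed.

Lemma w3_nmul v a b : w3 (nmul v a b) =
  (Phi 1 v (w2 a Lft) * w1 b Lft + Phi 2 v (w2 a Rgt) * w1 b Rgt
     + Phi 3 v (w2 a Mid) * w1 b Mid) +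
  (Phi 1 (act v) (w2 b Lft) * w1 a Lft + Phi 2 (act v) (w2 b Rgt) * w1 a Rgt
     + Phi 3 (act v) (w2 b Mid) * w1 a Mid).
Proof. by rewrite /nmul -[nmul0 v a b]scale1r w3_linear scale1r. Qed.

Lemma nilp_eq0 (a : nilp) :
  (forall i, w1 a i = 0) -> (forall i, w2 a i = 0) -> w3 a = 0 -> a = 0.
Proof.
case: a => [[a b] d] a0 b0 d0; congr (_, _, _) => //.
  by apply/ffunP => i; rewrite ffunE; apply: a0.
by apply/ffunP => i; rewrite ffunE; apply: b0.
Qed.

Lemma Phi0 u w : Phi u w 0 = 0.
Proof.
have /eqP := Phi_bilin.2 u w 1 0 0.
by rewrite !scale1r addr0 -subr_eq0 opprD addNKr oppr_eq0 => /eqP.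
Qed.

Local Notation eval := (eval nmul).

(** The coefficient of the tensor of the generators with indices p(1), p(2), p(3) in the tensor
    product of the weight 1 parts of the three inputs. *)
Definition coef3 (env : nat -> nilp) (p : nat -> nat) : k :=
  w1 (env 1%N) (slot_of (p 1%N)) * w1 (env 2%N) (slot_of (p 2%N))
    * w1 (env 3%N) (slot_of (p 3%N)).

Lemma w12_eval env t i : perm_eq (leaves t) S3 ->
  w1 (eval env t) i = 0 /\ w2 (eval env t) i = 0.
Proof.
move=> /stdP[u [b [b' [w [v [_ ->]]]]]].
by case: b; case: b'; rewrite /= w1_nmul w2_nmul !w1_nmul !(mul0r, mulr0) !scale0r addr0.
Qed.

(** A product of weight 2 takes two distinct generators and the last factor must be the third one,
    so only bijections between leaves and generators contribute; the bijection p contributes [Phi]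
    at the tree relabelled by p. *)
Lemma w3_eval env t : perm_eq (leaves t) S3 ->
  w3 (eval env t) = \sum_(q <- perms3) coef3 env (map123 q) *: evt Phi (map_tree id (map123 q) t).
Proof.
move=> /stdP[u [b [b' [w [v [uS ->]]]]]].
have E : w3 (eval env (std u b b' w v)) =
    w3 (nmul (twist b w) (nmul (twist b' v) (env (nxt u)) (env (nxt (nxt u)))) (env u)).
  by case: b; case: b'; rewrite /= ?nmul_sym.
have {}E : w3 (eval env (std u b b' w v)) = \sum_(i <- [:: 1; 2; 3]%N)
   (w1 (env (nxt u)) (slot_of (nxt i)) * w1 (env (nxt (nxt u))) (slot_of (nxt (nxt i)))
     * w1 (env u) (slot_of i) * Phi i (twist b w) (twist b' v) +
    w1 (env (nxt (nxt u))) (slot_of (nxt i)) * w1 (env (nxt u)) (slot_of (nxt (nxt i)))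
     * w1 (env u) (slot_of i) * Phi i (twist b w) (twist (~~ b') v)).
  rewrite E w3_nmul !w2_nmul !w1_nmul !mulr0 !addr0 !Phi_bilin.2.
  have P2 i c w' v' : Phi i w' (c *: v') = c * Phi i w' v'.
    by rewrite -[c *: v']addr0 Phi_bilin.2 Phi0 addr0.
  have -> : twist (~~ b') v = act (twist b' v) by case: (b'); rewrite /= ?actK.
  by rewrite !P2 !big_cons big_nil /= /GRing.scale /=; ring.
rewrite E {E} /perms3 !big_cons !big_nil /coef3.
have em p : perm3 p -> evt Phi (map_tree id p (std u b b' w v)) =
    Phi (p u) (twist b w) (twist (b' (+) orev p) v).
  by move=> pp; rewrite map_std // evt_std // perm3_in.
rewrite !em // /orev /= !addbT !addbF.
by case/S3P: uS => -> /=; rewrite /GRing.scale /=; ring.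
Qed.

Lemma relabel_kernel r env : has_leaves S3 r ->
  (forall s, perm3 s -> ev Phi (relabel s r) = 0) -> lift (eval env) r = 0.
Proof.
move=> [_ rL] r0; apply: nilp_eq0 => [i|i|].
- rewrite (lift_comp _ _ (w1_linear i)) lift.unlock big_seq big1 // => t /rL tL /=.
  by rewrite (w12_eval _ _ tL).1 scaler0.
- rewrite (lift_comp _ _ (w2_linear i)) lift.unlock big_seq big1 // => t /rL tL /=.
  by rewrite (w12_eval _ _ tL).2 scaler0.
rewrite (lift_comp _ _ w3_linear).
rewrite (lift_eq (psi := fun t =>
  \sum_(q <- perms3) coef3 env (map123 q) *: evt Phi (map_tree id (map123 q) t))).
  rewrite lift_sumr big_seq big1 // => q qP.
  by rewrite -ev_relabel r0 ?scaler0 //; apply: perms3P.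
by move=> t /rL; apply: w3_eval.
Qed.

Lemma kernel_ev f : has_leaves S3 f ->
  (forall env, lift (eval env) f = 0) -> ev Phi f = 0.
Proof.
move=> [_ fL] f0.
(* With the leaf i sent to the i-th generator, the identity is the only permutation with a nonzero
   coefficient. *)
pose env0 (x : nat) : nilp := ([ffun i => (i == slot_of x)%:R], 0, 0).
transitivity (w3 (lift (eval env0) f)); last by rewrite f0.
rewrite (lift_comp _ _ w3_linear); apply: lift_eq => t /fL tL /=.
rewrite w3_eval // /perms3 !big_cons big_nil /coef3 /w1 !ffunE /=.
rewrite !(mulr0, mul0r, scale0r, addr0) !mulr1 scale1r.
have /stdP[u [b [b' [w [v [uS ->]]]]]] := tL.
by rewrite map_std // !evt_std ?perm3_in //; case/S3P: uS => ->; rewrite addbF.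
Qed.

End Nilpotent.

Definition kills Phi (R : {malg k[tree U]} -> Prop) : Prop :=
  forall s r, perm3 s -> R r -> ev Phi (relabel s r) = 0.

(** This is what makes forms well defined on the quotient: if [Phi] kills the relabellings of [R],
    every element of [R] is an identity of the nilpotent algebra, and then so is the whole ideal;
    evaluation at the generators gives back [Phi]. *)
Lemma ideal_gen_ev Phi (R : {malg k[tree U]} -> Prop) f :
  bilinear_form Phi -> (forall r, R r -> has_leaves S3 r) -> kills Phi R ->
  has_leaves S3 f -> ideal_gen R f -> ev Phi f = 0.
Proof.
move=> Pb RL kR fL fR; apply: kernel_ev => //.
apply: (fR _ (eval_kernel_ideal (nmul_dec Pb) (nmul_l Pb) (nmul_sym _))) => r Rr env.
by apply: relabel_kernel => //; [apply: RL|move=> s ps; apply: kR].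
Qed.

End Forms.

(** * Congruences modulo an operadic ideal *)

Lemma sub_lin (k : fieldType) (M : lmodType k) (c : k) (x y x' y' : M) :
  (c *: x + y) - (c *: x' + y') = c *: (x - x') + (y - y').
Proof. by rewrite opprD addrACA scalerBr. Qed.

Section Ideals.
Variables (k : fieldType) (U : S2Mod k).
Local Notation F := {malg k[tree U]}.
Local Notation T u w v := (std (X := Vector.sort (carrier U)) u false false w v).

Lemma has_leaves_tb L (t : tree U) : uniq L -> perm_eq (leaves t) L -> has_leaves L (tb t).
Proof. by rewrite tb.unlock; apply: has_leavesU. Qed.

Section Congruence.
Variables (I : F -> Prop) (I_ideal : operadic_ideal I).

Lemma idealD f g : I f -> I g -> I (f + g).
Proof. by move=> If Ig; rewrite -[f]scale1r; apply: ideal_lin. Qed.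

Lemma idealZ c f : I f -> I (c *: f).
Proof. by move=> If; rewrite -[_ *: _]addr0; apply: ideal_lin (ideal0 _). Qed.

Lemma idealB f g : I f -> I g -> I (f - g).
Proof. by move=> If Ig; rewrite -scaleN1r; apply/idealD/idealZ. Qed.

Lemma ideal_sum (J : Type) (s : seq J) (f : J -> F) :
  (forall j, I (f j)) -> I (\sum_(j <- s) f j).
Proof. by move=> If; elim/big_rec: _ => [|j g _]; [apply: ideal0|apply: idealD]. Qed.

Lemma ideal_trans f g h : I (f - g) -> I (g - h) -> I (f - h).
Proof. by move=> fg gh; rewrite -[f](subrK g) -addrA; apply: idealD. Qed.

Lemma ideal_cong_sum (J : Type) (s : seq J) (f g : J -> F) :
  (forall j, I (f j - g j)) -> I (\sum_(j <- s) f j - \sum_(j <- s) g j).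
Proof. by move=> fg; rewrite -sumrB; apply: ideal_sum. Qed.

(** The tree with root [w] arises by grafting at a leaf labelled 0, a label outside 1, 2, 3, so that
    the side condition on label sets in [ideal_comp] holds. In this way relations at the root are
    carried to the inner vertex. *)
Lemma ideal_under_root u w g : u \in S3 -> has_leaves [:: nxt u; nxt (nxt u)] g -> I g ->
  I (lift (fun t => tb (Node w t (Leaf u))) g).
Proof.
move=> uS gL Ig.
have -> : lift (fun t => tb (Node w t (Leaf u))) g =
    comp_at 0 (tb (Node w (Leaf 0) (Leaf u))) g.
  rewrite /comp_at lin_extE lift_tb lin_extE; apply: lift_eq => t _.
  by rewrite tb.unlock /=; case/S3P: uS => ->.
apply: (@ideal_comp _ _ _ I_ideal [:: 0; u] _ _ _ _ _ gL) => //.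
- by apply: has_leaves_tb => //; case/S3P: uS => ->.
- move=> y; rewrite !inE.
  by case/S3P: uS => -> /orP[]/eqP->.
by right.
Qed.

Lemma ideal_cong_std u b b' (w v : U) : u \in S3 ->
  I (tb (std u b b' w v) - tb (T u (twist b w) (twist b' v))).
Proof.
move=> uS; pose t v b' := if b' then Node v (Leaf (nxt (nxt u))) (Leaf (nxt u))
               else Node v (Leaf (nxt u)) (Leaf (nxt (nxt u))) : tree U.
apply: (@ideal_trans _ (tb (std u false b' (twist b w) v))).
  case: b => /=; last by rewrite subrr; apply: ideal0.
  rewrite -opprB -scaleN1r; apply/idealZ/(ideal_free I_ideal).
  by apply: free_sym_tb; case/S3P: uS => ->; case: (b').
case: b' => /=; last by rewrite subrr; apply: ideal0.
have := @ideal_under_root u (twist b w) (tb (t v true) - tb (t (act v) false)) uS.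
rewrite liftB !lift_tb; apply.
  by apply: has_leavesB; apply: has_leaves_tb; rewrite /t; case/S3P: uS => ->.
rewrite -opprB -scaleN1r; apply/idealZ/(ideal_free I_ideal).
by apply: free_sym_tb; rewrite /t; case/S3P: uS => ->.
Qed.

Lemma ideal_cong_l u c (w w' v : U) : u \in S3 ->
  I (tb (T u (c *: w + w') v) - (c *: tb (T u w v) + tb (T u w' v))).
Proof.
move=> uS; rewrite opprD addrA; apply: (ideal_free I_ideal).
by apply: free_linear_tb; case/S3P: uS => ->.
Qed.

Lemma ideal_cong_r u c (w v v' : U) : u \in S3 ->
  I (tb (T u w (c *: v + v')) - (c *: tb (T u w v) + tb (T u w v'))).
Proof.
move=> uS; pose t v := Node v (Leaf (nxt u)) (Leaf (nxt (nxt u))) : tree U.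
pose g := tb (t (c *: v + v')) - c *: tb (t v) - tb (t v').
have <- : lift (fun t => tb (Node w t (Leaf u))) g =
    tb (T u w (c *: v + v')) - (c *: tb (T u w v) + tb (T u w v')).
  by rewrite /g 2!liftB liftZ 3!lift_tb opprD addrA.
apply: ideal_under_root => //; last first.
  by apply/(ideal_free I_ideal)/free_linear_tb; case/S3P: uS => ->.
have tL v1 : has_leaves [:: nxt u; nxt (nxt u)] (tb (t v1)).
  by apply: has_leaves_tb => //; rewrite /t; case/S3P: uS => ->.
by apply: has_leavesB (has_leavesB _ (has_leavesZ _ _)) _.
Qed.

Lemma ideal_cong_lsum (J : Type) (s : seq J) u (c : J -> k) (x : J -> U) (v : U) : u \in S3 ->
  I (tb (T u (\sum_(j <- s) c j *: x j) v) - \sum_(j <- s) c j *: tb (T u (x j) v)).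
Proof.
move=> uS; elim: s => [|j s IH].
  (* With the scalar -1 the two terms on the right cancel, which leaves the tree with a zero
     decoration. *)
  rewrite !big_nil subr0; have := @ideal_cong_l u (-1) 0 0 v uS.
  by rewrite scaler0 addr0 scaleN1r addNr subr0.
rewrite !big_cons; apply: ideal_trans (ideal_cong_l _ _ _ _ uS) _.
by rewrite opprD addrACA subrr add0r.
Qed.

Lemma ideal_cong_rsum (J : Type) (s : seq J) u (c : J -> k) (x : J -> U) (w : U) : u \in S3 ->
  I (tb (T u w (\sum_(j <- s) c j *: x j)) - \sum_(j <- s) c j *: tb (T u w (x j))).
Proof.
move=> uS; elim: s => [|j s IH].
  rewrite !big_nil subr0; have := @ideal_cong_r u (-1) w 0 0 uS.
  by rewrite scaler0 addr0 scaleN1r addNr subr0.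
rewrite !big_cons; apply: ideal_trans (ideal_cong_r _ _ _ _ uS) _.
by rewrite opprD addrACA subrr add0r.
Qed.

Section Expansion.
Variables (n : nat) (b : 'I_n -> U) (beta : 'I_n -> U -> k).
Hypothesis b_beta : forall x, x = \sum_i beta i x *: b i.

Definition coord_form u i j : nat -> U -> U -> k^o :=
  fun u' w v => if u' == u then beta i w * beta j v else 0.

Definition std_sum (c : nat -> 'I_n -> 'I_n -> k) : F :=
  \sum_(u <- S3) \sum_i \sum_j c u i j *: tb (T u (b i) (b j)).

(** The coefficients of the expansion are themselves values of forms, so an element on which all the
    coordinate forms vanish is 0 modulo every ideal. *)
Lemma ideal_expand f : has_leaves S3 f ->
  I (f - std_sum (fun u i j => ev (coord_form u i j) f)).
Proof.
move=> [_ fL]; apply: (lift_in (Q := fun f => I (f - std_sum _))) => [|c g h Ig Ih|t /fL].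
- rewrite /std_sum big1 ?subr0; first exact: ideal0.
  move=> u _; rewrite big1 // => i _; rewrite big1 // => j _.
  by rewrite /ev lift0 scale0r.
- suff -> : std_sum (fun u i j => ev (coord_form u i j) (c *: g + h)) =
    c *: std_sum (fun u i j => ev (coord_form u i j) g) +
    std_sum (fun u i j => ev (coord_form u i j) h).
    by move: (std_sum _) (std_sum _) Ig Ih => x y gx hy; rewrite sub_lin; apply: ideal_lin.
  rewrite /std_sum scaler_sumr -big_split; apply: eq_bigr => u _ /=.
  rewrite scaler_sumr -big_split; apply: eq_bigr => i _ /=.
  rewrite scaler_sumr -big_split; apply: eq_bigr => j _ /=.
  by rewrite /ev lift_linear scalerDl scalerA.
case/stdP=> u [b0 [b0' [w [v [uS ->]]]]].
have -> : << std u b0 b0' w v >> = tb (std u b0 b0' w v) by rewrite tb.unlock.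
apply: ideal_trans (ideal_cong_std _ _ _ _ uS) _.
set w' := twist _ w; set v' := twist _ v.
have -> : std_sum (fun u0 i j => ev (coord_form u0 i j) (tb (std u b0 b0' w v))) =
    \sum_i beta i w' *: \sum_j beta j v' *: tb (T u (b i) (b j)).
  rewrite /std_sum (bigD1_seq u) //= [X in _ + X]big1 ?addr0.
    apply: eq_bigr => i _; rewrite scaler_sumr; apply: eq_bigr => j _.
    have -> : ev (coord_form u i j) (tb (std u b0 b0' w v)) = beta i w' * beta j v'.
      by rewrite /ev lift_tb evt_std // /coord_form eqxx.
    by rewrite [RHS]scalerA.
  move=> u' /negPf u'u; rewrite big1 // => i _; rewrite big1 // => j _.
  by rewrite /ev lift_tb evt_std // /coord_form eq_sym u'u scale0r.
apply: (@ideal_trans _ (\sum_i beta i w' *: tb (T u (b i) v'))).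
  by rewrite {1}[w']b_beta; apply: ideal_cong_lsum.
apply: ideal_cong_sum => i; rewrite -scalerBr; apply: idealZ.
by rewrite {1}[v']b_beta; apply: ideal_cong_rsum.
Qed.

Lemma has_leaves_std_sum c : has_leaves S3 (std_sum c).
Proof.
rewrite /std_sum big_seq; elim/big_rec: _ => [|u f uS Lf]; first exact: has_leaves0.
rewrite -[X in X + f]scale1r; apply: has_leaves_lin => //.
do 2!(apply: has_leaves_sum => // ?); apply/has_leavesZ/has_leaves_tb => //.
exact: leaves_std.
Qed.

Lemma lift_std_sum (M : lmodType k) (phi : tree U -> M) c :
  lift phi (std_sum c) = \sum_(u <- S3) \sum_i \sum_j c u i j *: phi (T u (b i) (b j)).
Proof.
rewrite /std_sum (linear_sum (lift phi)); apply: eq_bigr => u _.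
rewrite (linear_sum (lift phi)); apply: eq_bigr => i _.
by rewrite (linear_sum (lift phi)); apply: eq_bigr => j _; rewrite linearZ /= lift_tb.
Qed.
End Expansion.
End Congruence.

Lemma ideal_gen_ideal R : operadic_ideal (@ideal_gen k U R).
Proof.
split.
- by move=> f ff I I_id _; apply: (ideal_free I_id).
- by move=> I I_id _; apply: ideal0.
- by move=> a f g If Ig I I_id RI; apply: (ideal_lin I_id); [apply: If|apply: Ig].
- move=> L s f fL sL If I I_id RI; apply: (ideal_relabel I_id fL sL).
  exact: If.
move=> L M x f g fL gM xL LM Ifg I I_id RI; apply: (ideal_comp I_id fL gM xL LM).
by case: Ifg => [If|Ig]; [left; apply: If|right; apply: Ig].
Qed.

Lemma free_zero_in (I : F -> Prop) f : operadic_ideal I -> free_zero f -> I f.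
Proof. by move=> I_id f0; apply: f0. Qed.

Lemma free_eq_ev (Phi : nat -> U -> U -> k^o) s (f g : F) : bilinear_form Phi -> perm3 s ->
  has_leaves S3 f -> has_leaves S3 g -> free_eq f g ->
  ev Phi (relabel s f) = ev Phi (relabel s g).
Proof.
move=> Pb ps fL gL fg; apply/eqP; rewrite -subr_eq0 /ev -liftB -map_formalB; apply/eqP.
have fgL : has_leaves S3 (f - g) by apply: has_leavesB.
have := ideal_relabel (ideal_gen_ideal (fun _ => False)) fgL (perm3_inj ps) fg.
apply: (@ideal_gen_ev _ _ Phi (fun _ => False) _ Pb) => //.
by apply: has_leaves_perm (ps) _; apply: has_leaves_map fgL; apply: perm3_inj.
Qed.
End Ideals.

Lemma relabel_linear (k : fieldType) (A : choiceType) s :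
  linear (relabel s : {malg k[tree A]} -> _).
Proof. exact: map_formal_linear. Qed.

Lemma ev_linear (k : fieldType) (U : S2Mod k) (Phi : nat -> U -> U -> k^o) :
  linear (ev Phi).
Proof. exact: lift_linear. Qed.

(** * Pulling ideals back along maps of S_2-modules *)

Section Transport.
Variables (k : fieldType) (U W : S2Mod k) (h : U -> W).
Hypotheses (h_lin : linear h) (h_act : forall x, h (act x) = act (h x)).

Lemma map_formal_tb s (t : tree U) : map_formal h s (tb t) = tb (map_tree h s t).
Proof. by rewrite !tb.unlock map_formalU. Qed.

Lemma map_formal_comp_at x (f g : {malg k[tree U]}) :
  map_formal h id (comp_at x f g) = comp_at x (map_formal h id f) (map_formal h id g).
Proof.
rewrite /comp_at /map_formal [LHS]lin_extE lift_lin_ext [RHS]lin_extE lift_map.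
apply: lift_eq => t _ /=; rewrite lift_map [RHS]lin_extE lift_map.
by apply: lift_eq => t' _ /=; rewrite map_tree_graft.
Qed.

(** A morphism of S_2-modules respects both kinds of free relations and commutes with relabelling
    and grafting. It serves to compare ideals along [theta] and along its inverse. *)
Lemma ideal_preim (I : {malg k[tree W]} -> Prop) : operadic_ideal I ->
  operadic_ideal (fun f : {malg k[tree U]} => I (map_formal h id f)).
Proof.
move=> I_id; split=> [||a f g If Ig|L s f fL sL If|L M x f g fL gM xL LM Ifg].
- apply: free_relationP => [a v w|v] l r lr.
    have -> : map_formal h id (tb (@Node U (a *: v + w) l r) - a *: tb (@Node U v l r)
        - tb (@Node U w l r)) = tb (@Node W (a *: h v + h w) (map_tree h id l) (map_tree h id r))
        - a *: tb (@Node W (h v) (map_tree h id l) (map_tree h id r))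
        - tb (@Node W (h w) (map_tree h id l) (map_tree h id r)).
      rewrite 2!map_formalB map_formalZ 3!map_formal_tb.
      by rewrite -h_lin.
    by apply/(ideal_free I_id)/free_linear_tb; rewrite !leaves_map !map_id.
  rewrite map_formalB 2!map_formal_tb /= h_act.
  by apply/(ideal_free I_id)/free_sym_tb; rewrite !leaves_map !map_id.
- by rewrite map_formal0; apply: ideal0.
- by rewrite map_formal_linear; apply: (ideal_lin I_id).
- rewrite /relabel map_formal_comp.
  have -> : map_formal (h \o id) (id \o s) f = relabel s (map_formal h id f).
    by rewrite /relabel map_formal_comp.
  by apply: (ideal_relabel I_id _ sL) => //; apply: has_leaves_map_id.
rewrite map_formal_comp_at; apply: (ideal_comp I_id _ _ xL LM) => //;
  exact: has_leaves_map_id.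
Qed.
End Transport.

(** * Elements of T(V^v)(3) as triples of bilinear forms on V *)

Section Pairing.
Variables (k : fieldType) (V : S2Mod k).
Local Notation D := (dualS2 V).
Local Notation T u w v := (std u false false w v).
Implicit Types (f : {malg k[tree D]}) (g : {malg k[tree V]}).

Definition pform_tree (u : nat) (w v : V) (t : tree D) : k^o :=
  if normal3 t is Some (u', phi, psi) then
    if u' == u then (phi : 'Hom(V, k^o)) w * (psi : 'Hom(V, k^o)) v else 0
  else 0.

(** The form through which f pairs with trees: its value at u, w, v is the pairing of f with w o_u
    v. *)
Definition pform f : nat -> V -> V -> k^o := fun u w v => lift (pform_tree u w v) f.

Lemma pform_lin c f f' u w v :
  pform (c *: f + f') u w v = c *: pform f u w v + pform f' u w v.
Proof. exact: lift_linear. Qed.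

Lemma pform_treeE t t' : pair_tree t' t = evt (fun u w v => pform_tree u w v t') t.
Proof.
rewrite /pair_tree /evt /pform_tree; case: (normal3 t') => [[[u' phi] psi]|] //.
by case: (normal3 t) => [[[u w] v]|].
Qed.

Lemma pairingE f g : pairing f g = ev (pform f) g.
Proof.
rewrite /pairing exchange_big /ev lift.unlock; apply: eq_bigr => t _.
rewrite /evt /pform; case E: (normal3 t) => [[[u w] v]|]; last first.
  rewrite scaler0 big1 // => t' _; rewrite pform_treeE /evt E mulr0 //.
rewrite lift.unlock scaler_sumr; apply: eq_bigr => t' _.
by rewrite pform_treeE /evt E /GRing.scale /= mulrCA mulrA.
Qed.

Lemma pform_tree_linear u t :
  (forall v, linear (fun w => pform_tree u w v t)) /\ (forall w, linear (pform_tree u w ^~ t)).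
Proof.
rewrite /pform_tree; case: (normal3 t) => [[[u' phi] psi]|]; last first.
  by split=> ? c ? ?; rewrite scaler0 addr0.
case: eqP => _; last by split=> ? c ? ?; rewrite scaler0 addr0.
split=> [v|w] c x y; rewrite linearP.
  by rewrite mulrDl -scalerAl.
by rewrite mulrDr -scalerAr.
Qed.

Lemma lift_pointwise (A : choiceType) (phi psi chi : A -> k^o) c (f : {malg k[A]}) :
  (forall a, phi a = c *: psi a + chi a) -> lift phi f = c *: lift psi f + lift chi f.
Proof.
move=> E; rewrite lift.unlock scaler_sumr -big_split; apply: eq_bigr => a _ /=.
by rewrite E scalerDr !scalerA mulrC.
Qed.

Lemma pform_bilinear f : bilinear_form (pform f).
Proof.
split=> [u v|u w] c x y; apply: lift_pointwise => t.
  exact: (pform_tree_linear u t).1.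
exact: (pform_tree_linear u t).2.
Qed.

Lemma S3_span_ev (Phi : nat -> V -> V -> k^o) (R : {malg k[tree V]} -> Prop) r :
  kills Phi R -> S3_span R r -> ev Phi r = 0.
Proof.
move=> PR Rr; suff E s : perm3 s -> ev Phi (relabel s r) = 0.
  by have := E _ perm3_id; rewrite /relabel map_formal_id.
elim: Rr s => {r} [r Rr|| a f g _ IHf _ IHg|s' f ps' _ IHf] s ps.
- exact: PR.
- by rewrite /relabel map_formal0 /ev lift0.
- have lin0 (x y : k^o) : x = 0 -> y = 0 -> a *: x + y = 0.
    by move=> -> ->; rewrite addr0 scaler0.
  by rewrite relabel_linear ev_linear; apply: lin0; [apply: IHf|apply: IHg].
by rewrite /relabel map_formal_comp; apply: IHf; apply: perm3_comp.
Qed.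

Lemma annihilatorP (R : {malg k[tree V]} -> Prop) f :
  annihilator R f <-> has_leaves S3 f /\ kills (pform f) R.
Proof.
split=> -[fL fR]; split=> //; last first.
  by move=> r Rr; rewrite pairingE; apply: S3_span_ev Rr.
move=> s r ps Rr.
by rewrite -pairingE; apply: fR; apply: S3_act => //; apply: S3_gen.
Qed.

Section DualBasis.
Variables (n : nat) (e : n.-tuple V).
Hypothesis e_basis : basis_of fullv e.

Definition dualb (i : 'I_n) : D := linfun (coord e i : V -> k^o).

Lemma dualbE i v : (dualb i : 'Hom(V, k^o)) v = coord e i v.
Proof. by rewrite /dualb lfunE. Qed.

Lemma coord_sum v : v = \sum_(i < n) coord e i v *: e`_i.
Proof. by apply: (coord_basis e_basis); rewrite memvf. Qed.

Lemma dualb_sum (phi : D) : phi = \sum_(i < n) ((phi : 'Hom(V, k^o)) e`_i : k) *: dualb i.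
Proof.
apply/lfunP => v; rewrite {1}[v]coord_sum linear_sum sum_lfunE.
apply: eq_bigr => i _; rewrite linearZ scale_lfunE dualbE /GRing.scale /=.
by rewrite mulrC.
Qed.

Lemma form_expand (Phi : nat -> V -> V -> k^o) u w v : bilinear_form Phi ->
  Phi u w v = \sum_(i < n) \sum_(j < n) Phi u e`_i e`_j * (coord e i w * coord e j v).
Proof.
move=> [Pl Pr].
pose L v : {linear V -> k^o} := HB.pack (fun w => Phi u w v)
   (GRing.isLinear.Build _ _ _ _ _ (Pl u v)).
pose Q w : {linear V -> k^o} := HB.pack (Phi u w) (GRing.isLinear.Build _ _ _ _ _ (Pr u w)).
rewrite {1}[w]coord_sum -[LHS]/(L v _) linear_sum; apply: eq_bigr => i _.
rewrite linearZ /= {1}[v]coord_sum -[X in _ *: X]/(Q _ _) linear_sum scaler_sumr.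
apply: eq_bigr => j _; rewrite linearZ /= /GRing.scale /=.
by rewrite mulrA mulrC.
Qed.

End DualBasis.

Lemma pform_tree_std u w v u' (phi psi : D) : u' \in S3 ->
  pform_tree u w v (T u' phi psi) =
  if u' == u then (phi : 'Hom(V, k^o)) w * (psi : 'Hom(V, k^o)) v else 0.
Proof. by move=> uS; rewrite /pform_tree normal3_std. Qed.

(** The preimage has the values of [Phi] at pairs of basis vectors as coefficients in the dual
    basis. Trees have only the types 1, 2, 3, whence the restriction on [u]. *)
Lemma pform_surj (Phi : nat -> V -> V -> k^o) : bilinear_form Phi ->
  exists2 f, has_leaves S3 f & forall u w v, u \in S3 -> pform f u w v = Phi u w v.
Proof.
move=> Pb; have e_basis := vbasisP (fullv : {vspace V}).
set e := vbasis _ in e_basis.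
pose c u (i j : 'I_(\dim {:V})) : k := Phi u e`_i e`_j.
exists (std_sum (dualb e) c) => [|u w v uS]; first exact: has_leaves_std_sum.
rewrite /pform lift_std_sum (bigD1_seq u) //= [X in _ + X]big1 ?addr0.
  rewrite (form_expand e_basis _ _ _ Pb); apply: eq_bigr => i _; apply: eq_bigr => j _.
  by rewrite pform_tree_std // eqxx !dualbE.
move=> u' /negPf u'u; rewrite big1 // => i _; rewrite big1 // => j _.
rewrite /pform_tree /= /orient; case: ifP => _; first by rewrite u'u scaler0.
by case: ifP => _; rewrite ?u'u scaler0.
Qed.

(** Nondegeneracy: the coefficients of f in the dual basis are the values of [pform f] at pairs of
    basis vectors. *)
Lemma pform_eq0 f : has_leaves S3 f ->
  (forall u w v, u \in S3 -> pform f u w v = 0) -> free_zero f.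
Proof.
move=> fL f0; have e_basis := vbasisP (fullv : {vspace V}).
set e := vbasis _ in e_basis.
have := ideal_expand (ideal_gen_ideal (fun _ => False)) (dualb_sum e_basis) fL.
set X := std_sum _ _; suff -> : X = 0 by rewrite subr0.
rewrite /X /std_sum big_seq big1 // => u uS; rewrite big1 // => i _; rewrite big1 // => j _.
suff -> : ev (coord_form (fun i (phi : D) => (phi : 'Hom(V, k^o)) e`_i) u i j) f = 0.
  by rewrite scale0r.
rewrite -(f0 u e`_i e`_j uS); apply: lift_eq => t _.
by rewrite /evt /pform_tree; case: (normal3 t) => [[[u' phi] psi]|].
Qed.
End Pairing.

(** * A choice of planar representatives *)

Section Planar.
Implicit Types s : tree unit.

Fixpoint first_leaf s : nat := match s with Leaf x => x | Node _ l _ => first_leaf l end.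

(** The first leaf of a normal form is its smallest one, so that subtrees are ordered by their
    smallest leaves. *)
Fixpoint planar_nf s : tree unit :=
  match s with
  | Leaf x => Leaf x
  | Node _ l r =>
      if (first_leaf (planar_nf l) < first_leaf (planar_nf r))%N
      then Node tt (planar_nf l) (planar_nf r) else Node tt (planar_nf r) (planar_nf l)
  end.

Lemma first_leaf_in s : first_leaf s \in leaves s.
Proof. by elim: s => /= [x|a l IHl r _]; rewrite ?inE // mem_cat IHl. Qed.

Lemma planar_iso_refl s : planar_iso s s.
Proof. by elim: s => [x|[] l IHl r IHr]; [apply: iso_leaf|apply: iso_node]. Qed.

Lemma planar_nf_iso s : planar_iso s (planar_nf s).
Proof.
elim: s => /= [x|[] l IHl r IHr]; first exact: iso_leaf.
by case: ifP => _; [apply: iso_node|apply: iso_swap].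
Qed.

Lemma planar_iso_leaves s s' : planar_iso s s' -> perm_eq (leaves s) (leaves s').
Proof.
elim=> // l r l' r' _ IHl _ IHr /=; first exact: perm_cat.
by rewrite perm_sym perm_catC perm_sym; apply: perm_cat.
Qed.

Lemma planar_iso_map f s s' : planar_iso s s' ->
  planar_iso (map_tree id f s) (map_tree id f s').
Proof. by elim=> * /=; [apply: iso_leaf|apply: iso_node|apply: iso_swap]. Qed.

Lemma planar_iso_nf s s' : planar_iso s s' -> uniq (leaves s) ->
  planar_nf s = planar_nf s'.
Proof.
elim=> //= l r l' r' ll' IHl rr' IHr; rewrite cat_uniq => /and3P[ul lr ur].
  by rewrite IHl ?IHr.
(* A tie between the first leaves would give a label common to both subtrees. *)
rewrite IHl // IHr //; case: ltngtP => // eq_first.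
case/hasP: lr; exists (first_leaf (planar_nf r)).
  rewrite (perm_mem (planar_iso_leaves (planar_nf_iso r))).
  exact: first_leaf_in.
rewrite IHr // -eq_first -IHl //= (perm_mem (planar_iso_leaves (planar_nf_iso l))).
exact: first_leaf_in.
Qed.

Lemma planar_nfK s : uniq (leaves s) -> planar_nf (planar_nf s) = planar_nf s.
Proof. by move=> us; rewrite -(planar_iso_nf (planar_nf_iso s)). Qed.

Definition std_shape u : tree unit := std u false false tt tt.

(** On the leaves 1, 2, 3 the representatives must be the cyclically oriented trees in which forms
    are computed; the order by smallest leaf, used for all other label sets, would reverse the inner
    vertex of one of them. *)
Definition planar_std s : bool :=
  if perm_eq (leaves s) S3 then s \in [seq std_shape u | u <- S3]
  else planar_nf s == s.

Lemma planar_stdP : planar_choice planar_std.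
Proof.
move=> s us; rewrite /planar_std; have [sS|sS] := boolP (perm_eq (leaves s) S3).
  have [u [b [b' [[] [[] [uS Es]]]]]] := stdP sS.
  have iso_u : planar_iso s (std_shape u).
    rewrite Es /std_shape /std {Es}; case: b; case: b' => /=.
    - by apply: iso_swap (iso_leaf _) (iso_swap _ _); apply: iso_leaf.
    - by apply: iso_swap (iso_leaf _) (iso_node _ _); apply: iso_leaf.
    - by apply: iso_node (iso_swap _ _) (iso_leaf _); apply: iso_leaf.
    - exact: planar_iso_refl.
  exists (std_shape u); split=> [|s' [ss' s'P]].
    split=> //; rewrite leaves_std //; exact: map_f.
  move: s'P; rewrite -(permPl (planar_iso_leaves ss')) sS.
  (* The three oriented shapes have distinct normal forms, hence are pairwise not isomorphic. *)
  have := planar_iso_nf iso_u us; rewrite (planar_iso_nf ss' us).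
  by case/S3P: uS => ->; rewrite !inE => + /or3P[]/eqP E; rewrite E.
exists (planar_nf s); split.
  split; first exact: planar_nf_iso.
  rewrite -(permPl (planar_iso_leaves (planar_nf_iso s))) (negPf sS).
  exact/eqP/planar_nfK.
move=> s' [ss']; rewrite -(permPl (planar_iso_leaves ss')) (negPf sS) => /eqP <-.
exact: planar_iso_nf.
Qed.
End Planar.

(** * Linear independence of the basis trees *)

Local Notation shape := Defs.shape.

Lemma twistK (k : fieldType) (V : S2Mod k) b : involutive (twist (U := V) b).
Proof. by case: b => v //=; rewrite actK. Qed.

Lemma twist_linear (k : fieldType) (V : S2Mod k) b : linear (twist (U := V) b).
Proof. by case: b => c x y //=; rewrite act_linear. Qed.

Lemma shape_std A u b b' (w v : A) : shape (std u b b' w v) = std u b b' tt tt.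
Proof. by case: b; case: b'. Qed.

Lemma leaves_shape A (t : tree A) : leaves (shape t) = leaves t.
Proof. by rewrite /shape leaves_map map_id. Qed.

Lemma std_iso u b b' c c' : planar_iso (std u b b' tt tt) (std u c c' tt tt).
Proof.
by case: b; case: b'; case: c; case: c';
  eauto using planar_iso, iso_leaf, iso_node, iso_swap.
Qed.

Lemma std_shape_inj u b b' c c' : u \in S3 ->
  std u b b' tt tt = std u c c' tt tt -> b = c /\ b' = c'.
Proof. by case/S3P=> ->; case: b; case: b'; case: c; case: c'. Qed.

Lemma map_tree_in_id A f (t : tree A) :
  {in leaves t, f =1 id} -> map_tree id f t = t.
Proof.
elim: t => /= [x fx|a l IHl r IHr flr]; first by rewrite fx ?inE.
by rewrite IHl ?IHr // => x xl; apply: flr; rewrite mem_cat xl ?orbT.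
Qed.

Lemma decorations_relabel A f (t : tree A) : decorations (map_tree id f t) = decorations t.
Proof. by elim: t => //= a l -> r ->. Qed.

Lemma all_decorations_std (A : eqType) (p : pred A) u b b' w v :
  all p (decorations (std u b b' w v)) = p w && p v.
Proof. by case: b; case: b'; rewrite /= andbT. Qed.

Section Independence.
Variables (k : fieldType) (V : S2Mod k) (e : seq V).
Hypothesis e_basis : basis_of fullv e.

(** Coordinates are indexed by the basis vector itself, because decorations of trees are vectors and
    not indices. *)
Definition coord_at (x v : V) : k^o :=
  if insub (index x e) is Some i then coord (in_tuple e) (i : 'I_(size e)) v else 0.

Lemma coord_at_linear x : linear (coord_at x).
Proof.
rewrite /coord_at; case: insub => [i|] c v w; first by rewrite linearP.
by rewrite scaler0 addr0.
Qed.

Lemma coord_atE x y : x \in e -> y \in e -> coord_at x y = (x == y)%:R.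
Proof.
move=> xe ye; rewrite /coord_at insubT ?index_mem //= => lt_x.
have lt_y : (index y e < size e)%N by rewrite index_mem.
rewrite -{1}[y](nth_index 0 ye) -[index y e]/(nat_of_ord (Ordinal lt_y)).
rewrite (@coord_free _ _ _ (in_tuple e)); last exact: basis_free e_basis.
congr (nat_of_bool _)%:R; rewrite -val_eqE /= eq_sym.
by apply/eqP/eqP => [E|-> //]; rewrite -[x](nth_index 0 xe) E nth_index.
Qed.

(** The form dual to the tree [std u b b' x y]: the twists undo those introduced by [normal3]. *)
Definition twisted_coord u b b' x y : nat -> V -> V -> k^o :=
  fun u' w v => if u' == u then coord_at x (twist b w) * coord_at y (twist b' v) else 0.

Lemma twisted_coord_bilinear u b b' x y : bilinear_form (twisted_coord u b b' x y).
Proof.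
split=> u' w c v v'; rewrite /twisted_coord; case: eqP => _; rewrite ?scaler0 ?addr0 //.
  by rewrite twist_linear coord_at_linear mulrDl -scalerAl.
by rewrite twist_linear coord_at_linear mulrDr -scalerAr.
Qed.

(** The form dual to one tree of the family kills the others: a tree of another type pairs to 0, and
    one of the same type is isomorphic in shape, hence has the same shape and the same twists, so
    that some decoration differs. *)
Lemma std_independent (X : eqType) (s : seq X) (g : X -> tree V) (c : X -> k) :
  uniq s -> {in s &, injective g} ->
  {in s, forall x, perm_eq (leaves (g x)) S3 /\ all (mem e) (decorations (g x))} ->
  {in s &, forall x y, planar_iso (shape (g x)) (shape (g y)) ->
     shape (g x) = shape (g y)} ->
  free_zero (\sum_(x <- s) c x *: << g x >>) -> {in s, forall x, c x = 0}.
Proof.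
move=> us g_inj gs g_shape free0 x xs; have [gL ge] := gs x xs.
have [u [b [b' [w [v [uS Eg]]]]]] := stdP gL.
move: (ge); rewrite Eg all_decorations_std => /andP[we ve].
have sumL : has_leaves S3 (\sum_(x <- s) c x *: << g x >> : {malg k[tree V]}).
  rewrite big_seq; elim/big_rec: _ => [|y f ys fL]; first exact: has_leaves0.
  by apply: has_leaves_lin => //; apply: has_leavesU => //; case: (gs y ys).
have := @ideal_gen_ev _ _ (twisted_coord u b b' w v) (fun _ => False) _
  (twisted_coord_bilinear u b b' w v) (fun _ F => match F with end)
  (fun _ _ _ F => match F with end) sumL free0.
rewrite /ev lift_sum (bigD1_seq x) //= big1_seq ?addr0.
  rewrite Eg evt_std // /twisted_coord eqxx !twistK !coord_atE // !eqxx !mulr1.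
  by rewrite /GRing.scale /= mulr1.
move=> y /andP[yx ys]; have [gyL gye] := gs y ys.
have [u1 [b1 [b1' [w1 [v1 [u1S Ey]]]]]] := stdP gyL.
move: gye; rewrite Ey all_decorations_std => /andP[w1e v1e].
rewrite evt_std // /twisted_coord; case: eqP => [Eu|_]; last by rewrite scaler0.
subst u1; have := g_shape y x ys xs; rewrite Ey Eg !shape_std.
case/(_ (std_iso _ _ _ _ _))/(std_shape_inj uS) => Eb Eb'; subst b1 b1'.
rewrite !twistK !coord_atE //; case: eqP => Ew; last by rewrite mul0r scaler0.
case: eqP => Ev; last by rewrite mulr0 scaler0.
by case/eqP: yx; apply: g_inj => //; rewrite Ey Eg Ew Ev.
Qed.

Lemma basis_tree_independent (P : tree unit -> Prop) L (s : seq (tree V)) c :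
  planar_choice P -> size L = 3%N -> uniq L -> uniq s ->
  {in s, forall t, basis_tree e P L t} ->
  free_zero (\sum_(t <- s) c t *: << t >>) -> {in s, forall t, c t = 0}.
Proof.
move=> P_choice sL uL us sB free0.
(* Forms exist only for the leaves 1, 2, 3; a label is replaced by its position in [L], counted from
   1. *)
pose tau x := (index x L).+1; pose tau' m := nth 0%N L m.-1.
have tauK x : x \in L -> tau' (tau x) = x by move=> xL; rewrite /tau' /tau nth_index.
have tau_inj : {in L &, injective tau} by apply: can_in_inj tauK.
have tauL : map tau L = S3.
  rewrite /tau; move: sL uL; clear; case: L => [|x [|y [|z []]]] //= _.
  rewrite !inE negb_or => /and3P[/andP[xy xz] yz _].
  by rewrite !eqxx (negPf xy) (negPf xz) (negPf yz).
have tau_treeK A (t : tree A) : {subset leaves t <= L} ->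
    map_tree id tau' (map_tree id tau t) = t.
  by move=> tL; rewrite map_treeK; apply: map_tree_in_id => x /tL /tauK.
have sub t : t \in s -> {subset leaves t <= L}.
  by case/sB=> tL _ _ x; rewrite (perm_mem tL).
have shape_tau t : shape (map_tree id tau t) = map_tree id tau (shape t) :> tree unit.
  by rewrite /shape !map_treeK.
apply: (@std_independent _ s (map_tree id tau) c us).
- by apply: (@can_in_inj _ _ _ _ (map_tree id tau')) => t /sub; apply: tau_treeK.
- move=> t /sB[tL te _]; rewrite leaves_map decorations_relabel -tauL; split=> //.
  exact: perm_map.
- move=> t t' ts t's; rewrite !shape_tau => /(planar_iso_map tau').
  have [[tL _ tP] [t'L _ t'P]] := (sB t ts, sB t' t's).
  rewrite !tau_treeK ?leaves_shape; [|exact: sub..] => iso_tt'.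
  have ut : uniq (leaves (shape t)) by rewrite leaves_shape (perm_uniq tL).
  have [s' [_ s'P]] := P_choice _ ut.
  by rewrite -(s'P (shape t)) ?(s'P (shape t')) //; split=> //; apply: planar_iso_refl.
have -> : \sum_(t <- s) c t *: << map_tree id tau t >> =
    relabel tau (\sum_(t <- s) c t *: << t >>) :> {malg k[tree V]}.
  by rewrite /relabel /map_formal lin_extE lift_sum.
apply: (ideal_relabel (ideal_gen_ideal _) _ tau_inj); last exact: free0.
rewrite big_seq; elim/big_rec: _ => [|t f ts fL]; first exact: has_leaves0.
by apply: has_leaves_lin => //; apply: has_leavesU => //; case: (sB t ts).
Qed.
End Independence.

Lemma Tri_tree_leaves (k : fieldType) (V : S2Mod k) J (t : tree V) t' :
  Tri_tree J t t' -> leaves t' = leaves t.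
Proof. by elim=> //= v u l r l' r' _ _ -> _ ->. Qed.

(** By independence all coefficients of an expansion of [r] vanish, and with them those of [w]. The
    formal sum 0 admits every label set [L]; if [L] does not have three elements, forms vanish on
    [w] because [normal3] fails on each tree. *)
Lemma Tri_elt_free_zero (k : fieldType) (V : S2Mod k) (Phi : nat -> TriV V -> TriV V -> k^o)
    s L J (r : {malg k[tree V]}) w : uniq L ->
  free_zero r -> Tri_elt L J r w -> ev Phi (relabel s w) = 0.
Proof.
move=> uL r0 [e [P [ts [c [h [[e_basis P_choice] [uts tsB] Er hT ->]]]]]].
have sum0 : free_zero (\sum_(t <- ts) c t *: << t >>).
  have := idealB (ideal_gen_ideal _) r0 Er.
  by rewrite opprB addrC subrK.
rewrite ev_relabel lift_sum big_seq big1 // => t t_ts.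
have [sL|sL] := eqVneq (size L) 3%N.
  by rewrite (basis_tree_independent e_basis P_choice sL uL uts tsB sum0 t_ts) scale0r.
rewrite /evt; case E: normal3 => [x|]; last by rewrite scaler0.
case/eqP: sL; have [tL _ _] := tsB t t_ts; rewrite -(perm_size tL).
rewrite -(Tri_tree_leaves (hT t t_ts)) -(size_map s) -(leaves_map id).
by apply: normal3_size; rewrite E.
Qed.

(** * Splitting trees with three leaves *)

Definition side (p q : bool) : option slot :=
  match p, q with
  | true, false => Some Lft
  | false, true => Some Rgt
  | true, true => Some Mid
  | false, false => None
  end.

Lemma turnE A J (l r : tree A) : turn J l r = side (meets J l) (meets J r).
Proof. by []. Qed.

(* The turns taken in [std u false false w v] at the root and at the other vertex. *)
Definition root_turn (J : seq nat) u := side ((nxt u \in J) || (nxt (nxt u) \in J)) (u \in J).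
Definition inner_turn (J : seq nat) u := side (nxt u \in J) (nxt (nxt u) \in J).

Definition swap_if (b : bool) (s : slot) := if b then slot_swap s else s.

Lemma swap_ifK b : involutive (swap_if b).
Proof. by case: b; case. Qed.

Lemma side_swap p q : side q p = omap slot_swap (side p q).
Proof. by case: p; case: q. Qed.

Lemma meets_leaf A J x : meets J (Leaf x : tree A) = (x \in J).
Proof. by rewrite /meets /= orbF. Qed.

Lemma meets_node A J (a : A) l r : meets J (Node a l r) = meets J l || meets J r.
Proof. by rewrite /meets /= has_cat. Qed.

Definition allows (o : option slot) (s : slot) : bool :=
  if o is Some s' then s == s' else true.

Lemma allows_swap b o s : allows (if b then omap slot_swap o else o) s = allows o (swap_if b s).
Proof. by case: b; case: o => [[]|]; case: s. Qed.

Section Splitting.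
Variables (k : fieldType) (V : S2Mod k).

Lemma act_binom (v : V) s : act (binom v s) = binom (act v) (slot_swap s).
Proof.
have act0 : act (0 : V) = 0.
  by have := @act_linear _ V (-1) 0 0; rewrite scaler0 addr0 scaleN1r addNr.
apply/ffunP => u; rewrite !ffunE; case: eqP => [<-|us].
  by case: u; rewrite eqxx.
by case: eqP => // E; case: us; rewrite E; case: s {E}.
Qed.

Lemma twist_binom b (v : V) s : twist b (binom v s) = binom (twist b v) (swap_if b s).
Proof. by rewrite /twist /swap_if; case: b => //; rewrite act_binom. Qed.

Definition TSu_dec (o : option slot) (v : V) : TSuV V :=
  if o is Some u then binom v u else binom v Lft + binom v Rgt + binom v Mid.

Lemma actD (U : S2Mod k) (x y : U) : act (x + y) = act x + act y.
Proof. by have := @act_linear _ U 1 x y; rewrite !scale1r. Qed.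

Lemma twist_TSu_dec b o v :
  twist b (TSu_dec (if b then omap slot_swap o else o) v) = TSu_dec o (twist b v).
Proof.
rewrite /twist; case: b => //; case: o => [s|]; first by rewrite act_binom; case: s.
by rewrite !actD !act_binom [_ + binom _ Lft]addrC.
Qed.

Lemma TSu_tree_std J u b b' (w v : V) :
  TSu_tree J (std u b b' w v) =
  std u b b' (TSu_dec (if b then omap slot_swap (root_turn J u) else root_turn J u) w)
    (TSu_dec (if b' then omap slot_swap (inner_turn J u) else inner_turn J u) v).
Proof.
rewrite /root_turn /inner_turn -!side_swap.
by case: b; case: b'; rewrite /= !turnE ?meets_node !meets_leaf // orbC.
Qed.

Lemma evt_TSu (Phi : nat -> TSuV V -> TSuV V -> k^o) J u b b' (w v : V) : u \in S3 ->
  evt Phi (TSu_tree J (std u b b' w v)) =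
  Phi u (TSu_dec (root_turn J u) (twist b w)) (TSu_dec (inner_turn J u) (twist b' v)).
Proof. by move=> uS; rewrite TSu_tree_std evt_std // !twist_TSu_dec. Qed.

Lemma leaves_TSu_tree J (t : tree V) : leaves (TSu_tree J t) = leaves t.
Proof. by elim: t => //= v l -> r ->. Qed.

Lemma meets_relabel A J J' s (t : tree A) :
  {in leaves t, forall x, (s x \in J') = (x \in J)} ->
  meets J' (map_tree id s t) = meets J t.
Proof.
by move=> sJ; rewrite /meets leaves_map has_map; apply: eq_in_has => x /sJ.
Qed.

Lemma TSu_tree_relabel J J' s (t : tree V) :
  {in leaves t, forall x, (s x \in J') = (x \in J)} ->
  map_tree id s (TSu_tree J t) = TSu_tree J' (map_tree id s t).
Proof.
elim: t => //= v l IHl r IHr sJ.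
have [sl sr] : {in leaves l, forall x, (s x \in J') = (x \in J)} /\
               {in leaves r, forall x, (s x \in J') = (x \in J)}.
  by split=> x xl; apply: sJ; rewrite mem_cat xl ?orbT.
by rewrite IHl // IHr // !turnE !(meets_relabel sl, meets_relabel sr).
Qed.

Lemma Tri_tree_relabel J J' s (t : tree V) t' :
  {in leaves t, forall x, (s x \in J') = (x \in J)} ->
  Tri_tree J t t' -> Tri_tree J' (map_tree id s t) (map_tree id s t').
Proof.
move=> + tt'; elim: tt' => /= [x _|v u l r l' r' lr _ IHl _ IHr sJ]; first exact: Tri_leaf.
have [sl sr] : {in leaves l, forall x, (s x \in J') = (x \in J)} /\
               {in leaves r, forall x, (s x \in J') = (x \in J)}.
  by split=> x xl; apply: sJ; rewrite mem_cat xl ?orbT.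
apply: Tri_node; [|exact: IHl|exact: IHr].
by rewrite turnE (meets_relabel sl) (meets_relabel sr).
Qed.

Lemma Tri_tree_inv J (t : tree V) t' : Tri_tree J t t' ->
  match t with
  | Leaf x => t' = Leaf x
  | Node v l r => exists u l' r', [/\ t' = Node (binom v u) l' r', allows (turn J l r) u,
                                     Tri_tree J l l' & Tri_tree J r r']
  end.
Proof.
case=> [//|v u l r l' r' lr ll rr]; exists u, l', r'; split=> //.
by case: lr => ->; rewrite /= ?eqxx.
Qed.

(** The slots [s] and [s'] are read on the reoriented tree, where the turns are [root_turn] and
    [inner_turn]; reversing a vertex exchanges left and right. *)
Lemma Tri_tree_std J u b b' (w v : V) t' : Tri_tree J (std u b b' w v) t' ->
  exists s s', [/\ t' = std u b b' (binom w (swap_if b s)) (binom v (swap_if b' s')),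
    allows (root_turn J u) s & allows (inner_turn J u) s'].
Proof.
have root_allows c s : allows (if c then side (u \in J) ((nxt u \in J) || (nxt (nxt u) \in J))
    else root_turn J u) s -> allows (root_turn J u) (swap_if c s).
  by rewrite -allows_swap; case: c; rewrite // side_swap.
have inner_allows c s : allows (if c then side (nxt (nxt u) \in J) (nxt u \in J)
    else inner_turn J u) s -> allows (inner_turn J u) (swap_if c s).
  by rewrite -allows_swap; case: c; rewrite // side_swap.
case: b; case: b' => /Tri_tree_inv[s [l [r [-> os]]]].
- move=> /Tri_tree_inv-> /Tri_tree_inv[s' [l' [r' [-> os' /Tri_tree_inv-> /Tri_tree_inv->]]]].
  exists (swap_if true s), (swap_if true s'); rewrite !swap_ifK; split=> //.
    by apply: (root_allows true); move: os; rewrite turnE meets_node !meets_leaf orbC.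
  by apply: (inner_allows true); move: os'; rewrite turnE !meets_leaf.
- move=> /Tri_tree_inv-> /Tri_tree_inv[s' [l' [r' [-> os' /Tri_tree_inv-> /Tri_tree_inv->]]]].
  exists (swap_if true s), (swap_if false s'); rewrite !swap_ifK; split=> //.
    by apply: (root_allows true); move: os; rewrite turnE meets_node !meets_leaf.
  by apply: (inner_allows false); move: os'; rewrite turnE !meets_leaf.
- move=> /Tri_tree_inv[s' [l' [r' [-> os' /Tri_tree_inv-> /Tri_tree_inv->]]]] /Tri_tree_inv->.
  exists (swap_if false s), (swap_if true s'); rewrite !swap_ifK; split=> //.
    by apply: (root_allows false); move: os; rewrite turnE meets_node !meets_leaf orbC.
  by apply: (inner_allows true); move: os'; rewrite turnE !meets_leaf.
move=> /Tri_tree_inv[s' [l' [r' [-> os' /Tri_tree_inv-> /Tri_tree_inv->]]]] /Tri_tree_inv->.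
exists (swap_if false s), (swap_if false s'); rewrite !swap_ifK; split=> //.
  by apply: (root_allows false); move: os; rewrite turnE meets_node !meets_leaf.
by apply: (inner_allows false); move: os'; rewrite turnE !meets_leaf.
Qed.

Lemma evt_Tri (Phi : nat -> TriV V -> TriV V -> k^o) J u b b' (w v : V) t' : u \in S3 ->
  Tri_tree J (std u b b' w v) t' -> exists s s',
  [/\ evt Phi t' = Phi u (binom (twist b w) s) (binom (twist b' v) s'),
      allows (root_turn J u) s & allows (inner_turn J u) s'].
Proof.
move=> uS /Tri_tree_std[s [s' [-> os os']]]; exists s, s'; split=> //.
by rewrite evt_std // !twist_binom !swap_ifK.
Qed.

End Splitting.

(** The duality in one vertex: the sum of the three labels in TSu pairs in the same way with each
    label, which matches the free choice of a label in Tri. Both are recorded by [allows]. *)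
Lemma theta_TSu_dec (k : fieldType) (V : S2Mod k) o (phi : dualS2 V) (x : V) s :
  (theta (TSu_dec o phi) : 'Hom(TriV V, k^o)) (binom x s) =
  if allows o s then (phi : 'Hom(V, k^o)) x else 0.
Proof.
have thetaD (f g : TSuV (dualS2 V)) : theta (f + g) = theta f + theta g.
  by have := @theta_linear _ V 1 f g; rewrite !scale1r.
case: o => [s'|] /=; first by rewrite theta_binom eq_sym.
by rewrite !thetaD !add_lfunE !theta_binom; case: s; rewrite /= !(addr0, add0r).
Qed.

Definition same3 (J K : seq nat) := all (fun x => (x \in J) == (x \in K)) S3.

(* The labels in [Tri_J] and [TSu_J] determine [J]. *)
Lemma allows_same J K u s s' : u \in S3 -> has (mem J) S3 -> has (mem K) S3 ->
  allows (root_turn K u) s -> allows (inner_turn K u) s' ->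
  allows (root_turn J u) s && allows (inner_turn J u) s' = same3 J K.
Proof.
rewrite /same3 /root_turn /inner_turn /= !orbF !andbT.
move=> uS; case/S3P: uS => -> /=;
  case: (1%N \in J); case: (2%N \in J); case: (3%N \in J) => //= _;
  case: (1%N \in K); case: (2%N \in K); case: (3%N \in K) => //= _;
  by case: s; case: s'.
Qed.

(** * The relations of TSu(P^!) annihilate Tri(R) *)

Section TSuKoszul.
Variables (k : fieldType) (V : S2Mod k).
Local Notation D := (dualS2 V).
Implicit Types f : {malg k[tree D]}.

Lemma theta_twist b (x : TSuV D) : theta (twist b x) = twist b (theta x).
Proof. by rewrite /twist; case: b => //; rewrite theta_act. Qed.

Lemma pform_TSu_tree J u (x y : V) s s' (t : tree D) : u \in S3 -> perm_eq (leaves t) S3 ->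
  pform_tree u (binom x s) (binom y s') (map_tree (@theta k V) id (TSu_tree J t)) =
  if allows (root_turn J u) s && allows (inner_turn J u) s' then pform_tree u x y t else 0.
Proof.
move=> uS /stdP[u' [b [b' [phi [psi [u'S ->]]]]]].
rewrite TSu_tree_std map_std_id /pform_tree !normal3_std // -!theta_twist !twist_TSu_dec.
case: eqP => [->|_]; last by case: ifP.
rewrite !theta_TSu_dec.
by case: allows => /=; case: allows; rewrite ?mulr0 ?mul0r.
Qed.

Lemma pform_TSu J u (x y : V) s s' f : u \in S3 -> has_leaves S3 f ->
  pform (map_formal (@theta k V) id (TSu_elt J f)) u (binom x s) (binom y s') =
  if allows (root_turn J u) s && allows (inner_turn J u) s' then pform f u x y else 0.
Proof.
move=> uS [_ fL]; rewrite /pform lift_map_formal /TSu_elt lift_map.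
have E := fun t tf => pform_TSu_tree J x y s s' uS (fL t tf).
case: ifP E => _ E; first exact: lift_eq.
by rewrite (lift_eq (psi := fun=> 0) E) lift.unlock big1 // => t _; rewrite scaler0.
Qed.
End TSuKoszul.

Lemma has_leaves_TSu (k : fieldType) (V : S2Mod k) L J (f : {malg k[tree V]}) :
  has_leaves L f -> has_leaves L (TSu_elt J f).
Proof.
move=> fL; have [uL _] := fL; apply: (has_leaves_lin_ext fL uL) => t _ tL.
by apply: has_leavesU => //; rewrite leaves_TSu_tree.
Qed.

(** Tree by tree, an element of Tri_K(r) relabelled by s pairs with TSu_J(f) as the relabelled r
    does with f if s(K) = J, and to 0 otherwise. This factor is the same for all trees of the
    expansion, so the total is a multiple of the pairing of f with a relabelling of r. *)
Lemma TSu_kills_Tri (k : fieldType) (P : binop k) J (f : {malg k[tree (dualS2 (gens P))]}) :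
  quadratic P -> has_leaves S3 f -> kills (pform f) (rels (b := P)) -> has (mem J) S3 ->
  kills (pform (map_formal (@theta k (gens P)) id (TSu_elt J f))) (rels (b := Tri P)).
Proof.
set V := gens P; set Psi := pform (map_formal _ _ _) => P_quad fL fR J0 s w ps.
case=> r [L [K [Rr rL K0 KL]]] Tw; have [uL _] := rL.
(* A nonzero formal sum determines its label set, which is then 1, 2, 3; the sum 0 does not and is
   treated apart. *)
have [r0|r_neq0] := eqVneq r 0.
  apply: Tri_elt_free_zero uL _ Tw; rewrite r0.
  exact: ideal0 (ideal_gen_ideal _).
have rS := P_quad r Rr; have LS := has_leaves_perm_eq rL rS r_neq0.
case: Tw => e [pl [ts [c [h [_ [_ tsB] Er hT ->]]]]].
have KS : {subset K <= S3} by move=> x /KL; rewrite (perm_mem LS).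
have evh t : t \in ts -> evt Psi (map_tree id s (h t)) =
    (same3 J (map s K))%:R *: evt (pform f) (map_tree id s t).
  move=> t_ts; have [tL _ _] := tsB t t_ts.
  have tS : perm_eq (leaves t) S3 := perm_trans tL LS.
  have sK : {in leaves t, forall x, (s x \in map s K) = (x \in K)}.
    move=> x; rewrite (perm_mem tS) => xS.
    by apply/mapP/idP => [[y yK /(perm3_inj ps xS (KS y yK)) ->]|xK]; last exists x.
  have := Tri_tree_relabel sK (hT t t_ts).
  have stS : perm_eq (leaves (map_tree id s t)) S3.
    by rewrite leaves_map (perm_trans (perm_map _ tS)).
  have [u [b [b' [x [y [uS Et]]]]]] := stdP stS; rewrite Et => Th.
  have [a [a' [-> al al']]] := evt_Tri Psi uS Th.
  have sK0 : has (mem (map s K)) S3.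
    case: (K) K0 KS => // z K' _ KS; apply/hasP; exists (s z); last exact: mem_head.
    by apply: perm3_in => //; apply: KS; apply: mem_head.
  rewrite /Psi pform_TSu // (allows_same uS J0 sK0 al al') evt_std //.
  by case: same3; rewrite ?scale1r ?scale0r.
have sumL : has_leaves S3 (\sum_(t <- ts) c t *: << t >> : {malg k[tree V]}).
  rewrite big_seq; elim/big_rec: _ => [|t g t_ts gL]; first exact: has_leaves0.
  apply: has_leaves_lin => //; apply: has_leavesU => //; have [tL _ _] := tsB t t_ts.
  exact: perm_trans tL LS.
have := fR s r ps Rr; rewrite (free_eq_ev (pform_bilinear f) ps rS sumL Er).
rewrite !ev_relabel !lift_sum => sum0.
have := congr1 (fun x : k^o => (same3 J (map s K))%:R *: x) sum0.
rewrite scaler0 => E; rewrite -[RHS]E scaler_sumr big_seq [RHS]big_seq.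
apply: eq_bigr => t t_ts.
by rewrite evh // !scalerA mulrC.
Qed.

(** * Generic bases *)

Section Generic.
Variables (k : fieldType) (k_infinite : infinite_field k).

Lemma infinite_field_uniq m : exists2 s : seq k, uniq s & size s = m.
Proof.
elim: m => [|m [s us sm]]; first by exists [::].
by have [x xs] := k_infinite s; exists (x :: s); rewrite /= ?xs ?sm.
Qed.

Lemma nonroot_exists (p : {poly k}) : p != 0 -> exists t, p.[t] != 0.
Proof.
move=> p0; have [s us sp] := infinite_field_uniq (size p).
have [/allP ps|] := boolP (all (root p) s).
  by have := max_poly_roots p0 (introT allP ps) us; rewrite sp ltnn.
by case/allPn=> t _; rewrite rootE; exists t.
Qed.

Variable n : nat.
Implicit Types A B M : 'M[k]_n.

(* A diagonal matrix has an off-diagonal coefficient in the basis where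
   one basis vector [e_i] is replaced by [e_i - e_j]. *)
Lemma offdiagonal_basis A : A != 0 -> exists M i j,
  [/\ M \in unitmx, (invmx M *m A *m (invmx M)^T) i j != 0 &
      i != j \/ (forall p : 'I_n, p = i)].
Proof.
move=> A0.
have [/existsP[i /existsP[j /andP[ij Aij]]]|] :=
    boolP [exists i, exists j, (i != j) && (A i j != 0)].
  exists 1%:M, i, j; rewrite unitmx1 invmx1 trmx1 mulmx1 mul1mx.
  by split=> //; left.
rewrite negb_exists => /forallP Adiag.
have {}Adiag i j : i != j -> A i j = 0.
  move=> ij; have := Adiag i; rewrite negb_exists => /forallP/(_ j).
  by rewrite ij negbK => /eqP.
have [i Aii] : exists i, A i i != 0.
  apply/existsP; rewrite -[X in is_true X]negbK negb_exists; apply/negP=> /forallP Az.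
  case/eqP: A0; apply/matrixP => p q; rewrite mxE.
  by have [->|/Adiag//] := eqVneq p q; have := Az q; rewrite negbK => /eqP.
(* If there is no second index, the dimension is 1 and j = i is the only possibility. *)
have [/existsP[j ji]|] := boolP [exists j, j != i]; last first.
  rewrite negb_exists => /forallP all_i; exists 1%:M, i, i.
  rewrite unitmx1 invmx1 trmx1 mulmx1 mul1mx; split=> //; right=> p.
  by have := all_i p; rewrite negbK => /eqP.
(* As d has square 0, 1 + d is the inverse of 1 - d, whose column i is e_i - e_j. The entry (i, j)
   of the transformed matrix is A i j + A i i, that is, A i i. *)
pose d : 'M[k]_n := delta_mx j i.
have dd : d *m d = 0 by rewrite mul_delta_mx_0 // eq_sym.
have NM : (1%:M + d) *m (1%:M - d) = 1%:M.
  by rewrite mulmxDl !mulmxBr !mul1mx mulmx1 dd subr0 subrK.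
have MU : 1%:M - d \in unitmx by case/mulmx1_unit: NM.
exists (1%:M - d), i, j; split=> //; last by left; rewrite eq_sym.
have -> : invmx (1%:M - d) = 1%:M + d.
  by have := mulmxK MU (1%:M + d); rewrite NM mul1mx.
have dA p : (d *m A) i p = 0.
  by rewrite mxE big1 // => q _; rewrite mxE eq_sym (negPf ji) mul0r.
have Xd (X : 'M[k]_n) : (X *m delta_mx i j) i j = X i i.
  rewrite mxE (bigD1 i) //= big1 ?addr0 => [|p pi]; first by rewrite mxE !eqxx mulr1.
  by rewrite mxE (negPf pi) mulr0.
rewrite linearD /= trmx1 trmx_delta mulmxDl mul1mx mulmxDr mulmx1 mxE Xd.
by rewrite ![(A + _ *m A) _ _]mxE !dA !addr0 Adiag ?add0r // eq_sym.
Qed.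

(** One matrix M0 meets the condition on [A], another one M1 that on [B]. Along the line through M0
    and M1 both conditions and invertibility are the nonvanishing of polynomials in t, none of which
    is zero; over an infinite field some t avoids all their roots. *)
Lemma generic_basis A B : A != 0 -> B != 0 -> exists M i j,
  [/\ M \in unitmx, (invmx M *m A *m (invmx M)^T) i j != 0 & (M^T *m B *m M) i j != 0].
Proof.
move=> A0 B0; have [M0 [i [j [M0U M0ij ij]]]] := offdiagonal_basis A0.
have [a [b Bab]] : exists a b, B a b != 0.
  have [/existsP[a /existsP[b Bab]]|] := boolP [exists a, exists b, B a b != 0].
    by exists a, b.
  rewrite negb_exists => /forallP Bz; case/eqP: B0; apply/matrixP => p q; rewrite mxE.
  by have := Bz p; rewrite negb_exists => /forallP/(_ q); rewrite negbK => /eqP.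
(* Columns i and j are the unit vectors of indices a and b, the other columns are 0. Invertibility
   is only asked of M0. Choosing two columns freely is possible because i and j differ, unless the
   dimension is 1. *)
pose M1 : 'M[k]_n :=
  \matrix_(p, q) (if q == i then p == a else (q == j) && (p == b))%:R.
have M1ij : (M1^T *m B *m M1) i j != 0.
  suff -> : (M1^T *m B *m M1) i j = B a b by [].
  rewrite mxE (bigD1 b) //= [X in _ + X]big1 ?addr0 => [|q qb]; last first.
    rewrite [M1 _ _]mxE; case: eqP => [ji|_]; last by rewrite (negPf qb) andbF mulr0.
    case: ij => [|all_i]; first by rewrite ji eqxx.
    by rewrite (all_i q) (all_i b) eqxx in qb.
  rewrite [M1 b j]mxE !eqxx /= (_ : (if _ then _ else _) = true) ?mulr1; last first.
    case: eqP => // ji; case: ij => [|all_i]; first by rewrite ji eqxx.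
    by rewrite (all_i a) (all_i b) eqxx.
  rewrite mxE (bigD1 a) //= big1 ?addr0 => [|p pa]; rewrite !mxE eqxx.
    by rewrite eqxx mul1r.
  by rewrite (negPf pa) mul0r.
(* The adjugate replaces the inverse, so that the condition on [A] becomes polynomial in the entries
   of M. *)
have adjE M : M \in unitmx -> (invmx M *m A *m (invmx M)^T) i j =
    (\det M)^-1 ^+ 2 * (\adj M *m A *m (\adj M)^T) i j.
  by move=> MU; rewrite /invmx MU linearZ /= -!scalemxAl -scalemxAr scalerA mxE expr2.
pose C (X : 'M[k]_n) : 'M[{poly k}]_n := map_mx polyC X.
pose MX := C M0 + 'X *: C (M1 - M0).
pose mt t := M0 + t *: (M1 - M0).
have MXt t : map_mx (horner_eval t) MX = mt t.
  by apply/matrixP => p q; rewrite /mt !mxE /horner_eval hornerD hornerM hornerX !hornerC.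
have Ct t X : map_mx (horner_eval t) (C X) = X.
  by apply/matrixP => p q; rewrite !mxE /horner_eval hornerC.
pose p1 := \det MX; pose p2 := (\adj MX *m C A *m (\adj MX)^T) i j.
pose p3 := (MX^T *m C B *m MX) i j.
have p1t t : p1.[t] = \det (mt t) by rewrite -MXt det_map_mx.
have p2t t : p2.[t] = (\adj (mt t) *m A *m (\adj (mt t))^T) i j.
  rewrite -[LHS]/(horner_eval t p2) -{1}[A](Ct t) -MXt -map_mx_adj map_trmx -!map_mxM.
  by rewrite [RHS]mxE.
have p3t t : p3.[t] = ((mt t)^T *m B *m mt t) i j.
  rewrite -[LHS]/(horner_eval t p3) -{1}[B](Ct t) -MXt map_trmx -!map_mxM.
  by rewrite [RHS]mxE.
have mt0 : mt 0 = M0 by rewrite /mt scale0r addr0.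
have mt1 : mt 1 = M1 by rewrite /mt scale1r addrC subrK.
have nz (p : {poly k}) t : p.[t] != 0 -> p != 0.
  by apply: contraNneq => ->; rewrite horner0.
have p1_nz : p1 != 0 by apply: (nz _ 0); rewrite p1t mt0 -unitfE -unitmxE.
have p2_nz : p2 != 0.
  by apply: (nz _ 0); rewrite p2t mt0; move: M0ij; rewrite adjE // mulf_eq0 negb_or => /andP[].
have p3_nz : p3 != 0 by apply: (nz _ 1); rewrite p3t mt1.
have [t] := nonroot_exists (mulf_neq0 (mulf_neq0 p1_nz p2_nz) p3_nz).
rewrite !hornerM !mulf_eq0 !negb_or => /andP[/andP[t1 t2] t3].
have tU : mt t \in unitmx by rewrite unitmxE unitfE -p1t.
exists (mt t), i, j; split=> //; last by rewrite -p3t.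
by rewrite adjE // mulf_neq0 -?p2t // expf_neq0 // invr_eq0 -p1t.
Qed.
End Generic.

(** * Explicit elements of Tri_J(r) *)

Section Expansions.
Variables (k : fieldType) (V : S2Mod k).
Local Notation T u w v := (std (X := Vector.sort (carrier V)) u false false w v).

Fixpoint tri_tree (d : slot) J (t : tree V) : tree (TriV V) :=
  match t with
  | Leaf x => Leaf x
  | Node v l r => Node (binom v (odflt d (turn J l r))) (tri_tree d J l) (tri_tree d J r)
  end.

Lemma tri_treeP d J t : Tri_tree J t (tri_tree d J t).
Proof.
elim: t => /= [x|v l IHl r IHr]; first exact: Tri_leaf.
by apply: Tri_node => //; case: turn => [s|]; [left|right].
Qed.

Section Basis.
Variables (n : nat) (e : n.-tuple V) (gamma : 'I_n -> V -> k).
Hypotheses (e_basis : basis_of fullv e) (e_gamma : forall x, x = \sum_i gamma i x *: e`_i).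

Lemma basis_nth_inj : injective (fun i : 'I_n => e`_i).
Proof.
move=> i j /eqP; rewrite nth_uniq ?size_tuple //; first by move/eqP/val_inj.
exact: free_uniq (basis_free e_basis).
Qed.

(** All the trees built on the basis are listed, those with coefficient 0 included, so that any of
    them can be singled out later. *)
Lemma std_expansion r : has_leaves S3 r -> exists ts c,
  [/\ uniq ts, forall t, t \in ts -> basis_tree e planar_std S3 t,
      free_eq r (\sum_(t <- ts) c t *: << t >>) &
      forall u (i j : 'I_n), u \in S3 -> T u e`_i e`_j \in ts /\
        c (T u e`_i e`_j) = ev (coord_form gamma u i j) r].
Proof.
move=> rL; pose g (q : nat * ('I_n * 'I_n)) := T q.1 e`_(q.2.1) e`_(q.2.2).
pose Q := [seq (u, p) | u <- S3, p <- index_enum ('I_n * 'I_n)%type].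
pose c0 (q : nat * ('I_n * 'I_n)) : k := ev (coord_form gamma q.1 q.2.1 q.2.2) r.
have g_inj : injective g.
  by case=> [u [i j]] [u' [i' j']] [] /basis_nth_inj-> /basis_nth_inj-> _ _ ->.
have uQ : uniq Q by apply: allpairs_uniq; rewrite ?index_enum_uniq // => -[? ?] [? ?].
have QP u i j : u \in S3 -> (u, (i, j)) \in Q.
  by move=> uS; apply: allpairs_f; rewrite ?mem_index_enum.
(* The coefficient has to be a function of the tree; as [g] is injective, the sum has at most one
   nonzero term. *)
pose c t := \sum_(q <- Q) (if g q == t then c0 q else 0).
have cE q : q \in Q -> c (g q) = c0 q.
  move=> qQ; rewrite /c (bigD1_seq q) //= eqxx big1 ?addr0 // => q' q'q.
  by rewrite (inj_eq g_inj) (negPf q'q).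
exists (map g Q), c; split=> [|t||u i j uS].
- by rewrite map_inj_uniq.
- case/mapP=> q /allpairsP[[u [i j]] /= [uS _ ->]] ->; split.
  + exact: leaves_std.
  + by rewrite all_decorations_std; apply/andP; split; apply: mem_nth; rewrite size_tuple.
  by rewrite shape_std /planar_std leaves_std //; apply: (map_f std_shape uS).
- have := ideal_expand (ideal_gen_ideal (fun _ => False)) e_gamma rL.
  rewrite /free_eq /free_zero.
  suff E : \sum_(t <- map g Q) c t *: << t >> =
    std_sum (fun i : 'I_n => e`_i) (fun u i j => ev (coord_form gamma u i j) r).
    by rewrite E => H; exact: H.
  rewrite big_map big_seq (eq_bigr (fun q => c0 q *: tb (g q))); last first.
    move=> q qQ; rewrite (cE _ qQ) tb.unlock; reflexivity.
  rewrite -big_seq /Q big_allpairs; apply: eq_bigr => u _.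
  by rewrite -(pair_big predT predT (fun i j => c0 (u, (i, j)) *: tb (g (u, (i, j))))).
split; first by apply/mapP; exists (u, (i, j)); rewrite ?QP.
by rewrite -[T _ _ _]/(g (u, (i, j))) cE // QP.
Qed.
End Basis.
End Expansions.

(** A nonzero coefficient of r occurs at some type u0, while independence of the free label is
    needed at every type u. A rotation passes from one to the other without reversing the inner
    vertex. *)
Lemma rotation u0 u : u0 \in S3 -> u \in S3 ->
  exists s, [/\ perm3 s, s u0 = u & orev s = false].
Proof.
move=> /S3P[]-> /S3P[]->;
  first [by exists (map123 (1, 2, 3)%N)|by exists (map123 (2, 3, 1)%N)|
         by exists (map123 (3, 1, 2)%N)].
Qed.

(** * Forms killing Tri(R) do not depend on free labels *)

Section TriAnnihilator.
Variables (k : fieldType) (P : binop k) (P_quad : quadratic P).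
Local Notation V := (gens P).
Local Notation T u w v := (std (X := Vector.sort (carrier V)) u false false w v).
Variable Phi : nat -> TriV V -> TriV V -> k^o.
Hypotheses (Phi_bilin : bilinear_form Phi) (Phi_kills : kills Phi (rels (b := Tri P))).

Lemma binom_linear u : linear (fun x : V => binom x u).
Proof. by move=> c x y; apply/ffunP => u'; rewrite !ffunE; case: eqP; rewrite ?scaler0 ?addr0. Qed.

(** In the oriented tree of type u the leaf u is to the right of the root: for J = {u} the root is
    labelled [Rgt] and the inner label is free. *)
Definition free_slot_diff u d : V -> V -> k^o := fun x y =>
  Phi u (binom x Rgt) (binom y d) - Phi u (binom x Rgt) (binom y Lft).

Lemma free_slot_diff_bilinear u d :
  bilinear_form (fun _ : nat => free_slot_diff u d).
Proof.
split=> _ z c x y; rewrite /free_slot_diff !binom_linear.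
  by rewrite !Phi_bilin.1 sub_lin.
by rewrite !Phi_bilin.2 sub_lin.
Qed.

Lemma tri_tree_last u d (x y : V) : u \in S3 ->
  tri_tree d [:: u] (T u x y) = std u false false (binom x Rgt) (binom y d).
Proof. by case/S3P=> ->. Qed.

(* Compares two elements of [Tri_{u0}(r)] that differ only in the free label of the
   tree [T u0 e`_i e`_j]. *)
Lemma free_slot_diff_basis n (e : n.-tuple V) (gamma : 'I_n -> V -> k) r u0 u d (i j : 'I_n) :
  basis_of fullv e -> (forall x, x = \sum_i gamma i x *: e`_i) ->
  rels r -> u0 \in S3 -> u \in S3 ->
  ev (coord_form gamma u0 i j) r != 0 -> free_slot_diff u d e`_i e`_j = 0.
Proof.
move=> e_basis e_gamma Rr u0S uS.
have rS := P_quad Rr.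
have [ts [c [uts tsB Er tsP]]] := std_expansion e_basis e_gamma rS.
have [t0_ts <-] := tsP u0 i j u0S; set t0 := T u0 _ _ in t0_ts * => ct0.
have [s [ps su os]] := rotation u0S uS.
pose h1 (t : tree V) := tri_tree Lft [:: u0] t.
pose h2 (t : tree V) := if t == t0 then tri_tree d [:: u0] t else h1 t.
have elt h : (forall t, Tri_tree [:: u0] t (h t)) ->
    \sum_(t <- ts) c t *: evt Phi (map_tree id s (h t)) = 0.
  move=> hT; rewrite -(lift_sum (fun t => evt Phi (map_tree id s t))) -ev_relabel.
  apply: Phi_kills ps _; exists r, S3, [:: u0]; split.
  - exact: Rr.
  - exact: rS.
  - by [].
  - by move=> x; rewrite inE => /eqP->.
  exists e, planar_std, ts, c, h; split.
  - by split; [apply: e_basis|apply: planar_stdP].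
  - by split; [apply: uts|apply: tsB].
  - exact: Er.
  - by move=> t _; apply: hT.
  reflexivity.
have z1 : _ = 0 := elt h1 (tri_treeP _ _).
have h2P t : Tri_tree [:: u0] t (h2 t).
  by rewrite /h2; case: eqP => _; apply: tri_treeP.
have z2 : _ = 0 := elt h2 h2P.
have : c t0 *: (evt Phi (map_tree id s (h2 t0)) - evt Phi (map_tree id s (h1 t0))) = 0.
  rewrite -[RHS](subrr 0) -[X in _ = X - _]z2 -[X in _ = _ - X]z1 -sumrB.
  rewrite (bigD1_seq t0) //= big1 ?addr0 ?scalerBr //.
  by move=> t /negPf tt0; rewrite /h2 tt0 subrr.
rewrite /h2 eqxx /h1 !tri_tree_last // !map_std // os su !evt_std //= => /eqP.
by rewrite scaler_eq0 (negPf ct0) => /eqP.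
Qed.

(** If the difference were a nonzero form, a generic basis would have a pair (i, j) at which both
    this form and a coefficient of [r] are nonzero, against [free_slot_diff_basis]. *)
Lemma free_slot_irrelevant r u d x y : infinite_field k ->
  rels (b := P) r -> ~ free_zero r -> u \in S3 ->
  Phi u (binom x Rgt) (binom y d) = Phi u (binom x Rgt) (binom y Lft).
Proof.
move=> k_inf Rr r_neq0 uS; apply/eqP; rewrite -subr_eq0 -/(free_slot_diff u d x y).
have rS := P_quad Rr.
have e0_basis := vbasisP (fullv : {vspace V}); set e0 := vbasis _ in e0_basis.
set n := \dim _ in e0 e0_basis *.
pose A u0 : 'M[k]_n := \matrix_(i, j) ev (coord_form (coord e0) u0 i j) r.
(* If the coefficients vanish at all three types, the expansion shows that [r] is 0 in T(V). *)
have [/allP A0|/allPn[u0 u0S A_neq0]] := boolP (all (fun u0 => A u0 == 0) S3).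
  case: r_neq0.
  have := ideal_expand (ideal_gen_ideal (fun _ => False)) (coord_sum e0_basis) rS.
  set X := std_sum _ _; suff -> : X = 0 by rewrite subr0.
  rewrite /X /std_sum big_seq big1 // => u0 u0S.
  rewrite big1 // => i _; rewrite big1 // => j _.
  have /eqP/matrixP/(_ i j) := A0 u0 u0S; rewrite !mxE => ->; exact: scale0r.
pose B : 'M[k]_n := \matrix_(i, j) free_slot_diff u d e0`_i e0`_j.
have [B0|B_neq0] := eqVneq B 0.
  have -> := form_expand e0_basis 0 x y (free_slot_diff_bilinear u d).
  rewrite big1 // => i _; rewrite big1 // => j _.
  by have /matrixP/(_ i j) := B0; rewrite !mxE => ->; rewrite mul0r.
have [M [i [j [MU Aij Bij]]]] := generic_basis k_inf A_neq0 B_neq0.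
pose e := [tuple \sum_(p < n) M p q *: e0`_p | q < n].
have eE (q : 'I_n) : e`_q = \sum_(p < n) M p q *: e0`_p by rewrite -tnth_nth tnth_mktuple.
(* Vectors change by M and coordinates by its inverse, whence the two transformation rules in
   [generic_basis]. *)
pose gamma q z := \sum_(p < n) invmx M q p * coord e0 p z.
have e_gamma z : z = \sum_(q < n) gamma q z *: e`_q.
  rewrite {1}(coord_sum e0_basis z).
  under [RHS]eq_bigr do rewrite eE scaler_sumr.
  rewrite exchange_big; apply: eq_bigr => p _ /=.
  under eq_bigr do rewrite scalerA.
  rewrite -scaler_suml; congr (_ *: _).
  under eq_bigr do rewrite /gamma mulrC mulr_sumr.
  rewrite exchange_big /= (bigD1 p) //= [X in _ + X]big1 ?addr0 => [|p' p'p].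
    under eq_bigr do rewrite mulrA.
    rewrite -mulr_suml; have := mulmxV MU => /matrixP/(_ p p); rewrite !mxE eqxx => ->.
    by rewrite mul1r.
  under eq_bigr do rewrite mulrA.
  rewrite -mulr_suml; have := mulmxV MU => /matrixP/(_ p p'); rewrite !mxE eq_sym (negPf p'p) => ->.
  by rewrite mul0r.
have e_basis : basis_of fullv e.
  rewrite basisEdim size_tuple leqnn andbT; apply/subvP => z _.
  rewrite (e_gamma z); apply: memv_suml => q _; apply: memvZ.
  by apply: memv_span; apply: mem_nth; rewrite size_tuple.
case/eqP: Bij.
have eAij : ev (coord_form gamma u0 i j) r = (invmx M *m A u0 *m (invmx M)^T) i j.
  transitivity (lift (fun t => \sum_(q < n) invmx M j q *:
      (\sum_(p < n) invmx M i p *: evt (coord_form (coord e0) u0 p q) t)) r).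
    apply: lift_eq => t _; rewrite /evt; case: normal3 => [[[u' w] v]|]; last first.
      by rewrite big1 // => q _; rewrite big1 ?scaler0 // => p _; rewrite scaler0.
    rewrite /coord_form; case: eqP => _; last first.
      by rewrite big1 // => q _; rewrite big1 ?scaler0 // => p _; rewrite scaler0.
    rewrite mulrC /gamma mulr_suml; apply: eq_bigr => q _.
    rewrite mulr_sumr scaler_sumr; apply: eq_bigr => p _.
    by rewrite /GRing.scale /=; ring.
  rewrite lift_sumr mxE; apply: eq_bigr => q _; rewrite lift_sumr [X in _ = _ * X]mxE mulrC.
  congr (_ * _); rewrite mxE; apply: eq_bigr => p _.
  by rewrite [A u0 p q]mxE.
rewrite -eAij in Aij.
rewrite -(free_slot_diff_basis d e_basis e_gamma Rr u0S uS Aij).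
rewrite (form_expand e0_basis 0 _ _ (free_slot_diff_bilinear u d)) mxE exchange_big.
apply: eq_bigr => q _; rewrite mxE mulr_suml; apply: eq_bigr => p _.
have coordE (a b : 'I_n) : coord e0 a e`_b = M a b.
  rewrite eE; under eq_bigr do [].
  exact: coord_sum_free (basis_free e0_basis).
by rewrite !coordE !mxE; ring.
Qed.

End TriAnnihilator.

(** * Splitting a form that kills Tri(R) into elements of TSu(R^perp) *)

Section SplitForm.
Variables (k : fieldType) (P : binop k) (P_quad : quadratic P).
Local Notation V := (gens P).
Local Notation D := (dualS2 V).
Variable Phi : nat -> TriV V -> TriV V -> k^o.
Hypotheses (Phi_bilin : bilinear_form Phi) (Phi_kills : kills Phi (rels (b := Tri P))).
Hypothesis Phi_free : forall u d x y, u \in S3 ->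
  Phi u (binom x Rgt) (binom y d) = Phi u (binom x Rgt) (binom y Lft).

(** For nonempty J inside 1, 2, 3 the root always has a turn; the default [Lft] is used only at the
    inner vertex, when J = {u}, and there [Phi_free] makes its choice immaterial. *)
Definition split_form J : nat -> V -> V -> k^o := fun u x y =>
  Phi u (binom x (odflt Lft (root_turn J u))) (binom y (odflt Lft (inner_turn J u))).

Lemma split_form_bilinear J : bilinear_form (split_form J).
Proof.
by split=> u z c x y; rewrite /split_form binom_linear ?Phi_bilin.1 ?Phi_bilin.2.
Qed.

Lemma split_form_allows J u x y s s' : u \in S3 -> has (mem J) S3 ->
  allows (root_turn J u) s -> allows (inner_turn J u) s' ->
  Phi u (binom x s) (binom y s') = split_form J u x y.
Proof.
move=> uS J0; rewrite /split_form.
have : (nxt u \in J) || (nxt (nxt u) \in J) || (u \in J).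
  by move: J0 => /=; case/S3P: uS => -> /=; do 3!case: (_ \in J).
rewrite /root_turn /inner_turn.
case: (nxt u \in J); case: (nxt (nxt u) \in J); case: (u \in J) => //= _ /eqP-> al;
  first [by rewrite (eqP al)|exact: Phi_free].
Qed.

Lemma evt_tri_tree J (t : tree V) : perm_eq (leaves t) S3 -> has (mem J) S3 ->
  evt Phi (tri_tree Lft J t) = evt (split_form J) t.
Proof.
move=> /stdP[u [b [b' [w [v [uS ->]]]]]] J0.
have [s [s' [-> al al']]] := evt_Tri Phi uS (tri_treeP Lft J (std u b b' w v)).
by rewrite (split_form_allows _ _ uS J0 al al') evt_std.
Qed.

Lemma tri_tree_relabel d J J' s (t : tree V) :
  {in leaves t, forall x, (s x \in J') = (x \in J)} ->
  map_tree id s (tri_tree d J t) = tri_tree d J' (map_tree id s t).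
Proof.
elim: t => //= v l IHl r IHr sJ.
have [sl sr] : {in leaves l, forall x, (s x \in J') = (x \in J)} /\
               {in leaves r, forall x, (s x \in J') = (x \in J)}.
  by split=> x xl; apply: sJ; rewrite mem_cat xl ?orbT.
by rewrite IHl // IHr // !turnE !(meets_relabel sl, meets_relabel sr).
Qed.

(** On trees with leaves 1, 2, 3, [split_form J] is [Phi] evaluated on one particular element of
    Tri_J, so its vanishing on relabellings of R is an instance of [Phi_kills]. *)
Lemma split_form_kills J : has (mem J) S3 -> {subset J <= S3} ->
  kills (split_form J) (rels (b := P)).
Proof.
move=> J0 JS s r ps Rr; have rS := P_quad Rr.
have e_basis := vbasisP (fullv : {vspace V}).
have [ts [c [uts tsB Er _]]] := std_expansion e_basis (coord_sum e_basis) rS.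
have tL t : t \in ts -> perm_eq (leaves t) S3 by case/tsB.
have sumL : has_leaves S3 (\sum_(t <- ts) c t *: << t >> : {malg k[tree V]}).
  rewrite big_seq; elim/big_rec: _ => [|t g t_ts gL]; first exact: has_leaves0.
  by apply: has_leaves_lin => //; apply: has_leavesU => //; apply: tL.
rewrite (free_eq_ev (split_form_bilinear J) ps rS sumL Er) ev_relabel lift_sum.
(* The preimage of J under s: relabelling by s carries the labels of Tri_K to those of Tri_J. *)
pose K := [seq x <- S3 | s x \in J].
have KP x : x \in S3 -> (s x \in J) = (x \in K) by move=> xS; rewrite mem_filter xS andbT.
pose w := \sum_(t <- ts) c t *: << tri_tree Lft K t >> : {malg k[tree (TriV V)]}.
have w0 : ev Phi (relabel s w) = 0.
  apply: (Phi_kills ps); exists r, S3, K; split.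
  - exact: Rr.
  - exact: rS.
  - case/hasP: J0 => x xS xJ; have := perm_mem ps x; rewrite xS => /mapP[y yS Exy].
    by apply/eqP=> K0; have := KP y yS; rewrite K0 -Exy [_ \in J]xJ.
  - by move=> x; rewrite mem_filter => /andP[].
  exists (vbasis {:V}), planar_std, ts, c, (fun t => tri_tree Lft K t); split.
  - by split; [apply: e_basis|apply: planar_stdP].
  - by split; [apply: uts|apply: tsB].
  - exact: Er.
  - by move=> t _; apply: tri_treeP.
  reflexivity.
rewrite -[RHS]w0 ev_relabel lift_sum big_seq [RHS]big_seq; apply: eq_bigr => t t_ts.
congr (_ *: _); rewrite (@tri_tree_relabel _ K J); last first.
  by move=> x; rewrite (perm_mem (tL t t_ts)) => /KP.
rewrite evt_tri_tree // leaves_map.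
by apply: perm_trans (perm_map _ (tL t t_ts)) _.
Qed.

Definition subsets3 : seq (seq nat) :=
  [:: [:: 1]; [:: 2]; [:: 3]; [:: 1; 2]; [:: 1; 3]; [:: 2; 3]; S3]%N.

(** For a given type u, the nine pairs of labels are distributed among the seven nonempty subsets: J
    = {u} receives the three pairs with root label [Rgt], each other subset exactly one pair. *)
Lemma split_form_sum u x y s s' : u \in S3 ->
  \sum_(J <- subsets3) (if allows (root_turn J u) s && allows (inner_turn J u) s'
    then split_form J u x y else 0) = Phi u (binom x s) (binom y s').
Proof.
move=> uS; rewrite /subsets3 !big_cons big_nil.
by case/S3P: (uS) => E; rewrite E in uS *; case: s; case: s';
  rewrite /= !(addr0, add0r) /split_form /= ?Phi_free // [RHS]Phi_free.
Qed.

(** [G] is the sum over [Js] of TSu_J(F_J), where F_J in R^perp is the element with form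
    [split_form J]. Taking all nonempty subsets gives an element with form [Phi]. *)
Lemma TSu_preimage (I : {malg k[tree (TSuV D)]} -> Prop) (Js : seq (seq nat)) :
  operadic_ideal I ->
  (forall w, rels (b := TSu (koszul P)) w -> I w) ->
  (forall J, J \in Js -> has (mem J) S3 /\ {subset J <= S3}) ->
  exists G, [/\ I G, has_leaves S3 G & forall u x y s s', u \in S3 ->
    pform (map_formal (@theta k V) id G) u (binom x s) (binom y s') =
    \sum_(J <- Js) (if allows (root_turn J u) s && allows (inner_turn J u) s'
      then split_form J u x y else 0)].
Proof.
move=> I_id I_rels; elim: Js => [|J Js IH] JsP.
  exists 0; split=> [||u x y s s' _]; [exact: ideal0|exact: has_leaves0|].
  by rewrite big_nil map_formal0 /pform lift0.
have [|G [IG GL GE]] := IH; first by move=> K KJs; apply: JsP; rewrite inE KJs orbT.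
have [J0 JS] := JsP J (mem_head _ _).
have [F FL FE] := pform_surj (split_form_bilinear J).
exists (1 *: TSu_elt J F + G); split=> [||u x y s s' uS].
- apply: (ideal_lin I_id) IG; apply: I_rels; exists F, S3, J; split.
  + apply/annihilatorP; split=> // s r ps Rr.
    rewrite -(split_form_kills J0 JS ps Rr); apply: eq_ev => t.
    have rsL := has_leaves_map id (perm3_inj ps) (P_quad Rr).
    move/(rsL.2) => tL; have [u [b [b' [w [v [uS ->]]]]]] := stdP (perm_trans tL ps).
    by rewrite !evt_std // FE.
  + exact: FL.
  + by case/hasP: J0 => x _; case: (J).
  + exact: JS.
  + by [].
- by apply: has_leaves_lin => //; apply: has_leaves_TSu.
have -> := map_formal_linear (@theta k V) id 1 (TSu_elt J F) G.
have -> := pform_lin 1 (map_formal (@theta k V) id (TSu_elt J F)) (map_formal (@theta k V) id G).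
rewrite big_cons scale1r; congr (_ + _); last exact: GE.
by rewrite (pform_TSu J x y s s' uS FL) (FE _ _ _ uS).
Qed.
End SplitForm.

(** * Comparison of the two ideals *)

Section FormOnSplit.
Variables (k : fieldType) (V : S2Mod k).

Lemma split_sum (X : splitS2 V) : X = 1 *: binom (X Lft) Lft +
  (1 *: binom (X Rgt) Rgt + binom (X Mid) Mid).
Proof.
by apply/ffunP => u; rewrite !scale1r !ffunE; case: u; rewrite /= ?(addr0, add0r).
Qed.

Lemma form_binom_eq0 (Phi : nat -> splitS2 V -> splitS2 V -> k^o) u : bilinear_form Phi ->
  (forall x y s s', Phi u (binom x s) (binom y s') = 0) -> forall X Y, Phi u X Y = 0.
Proof.
move=> [Pl Pr] P0 X Y; have {}P0 x s : Phi u (binom x s) Y = 0.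
  by rewrite (split_sum Y) !Pr !P0 !scaler0 !addr0.
by rewrite (split_sum X) !Pl !P0 !scaler0 !addr0.
Qed.
End FormOnSplit.

Section Main.
Variables (k : fieldType) (P : binop k) (P_quad : quadratic P).
Local Notation V := (gens P).
Local Notation D := (dualS2 V).
Local Notation theta := (@theta k V).

Lemma koszul_has_leaves (Q : binop k) r : rels (b := koszul Q) r -> has_leaves S3 r.
Proof. by case. Qed.

Lemma TSu_relP (Q : binop k) w : quadratic Q -> rels (b := TSu Q) w ->
  w = 0 \/ exists r J, [/\ rels (b := Q) r, has_leaves S3 r, has (mem J) S3,
                            {subset J <= S3} & w = TSu_elt J r].
Proof.
move=> Q_quad [r [L [J [Rr rL J0 JL ->]]]].
have [->|r_neq0] := eqVneq r 0; first by left; rewrite /TSu_elt lin_extE lift0.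
have LS := has_leaves_perm_eq rL (Q_quad r Rr) r_neq0.
have JS : {subset J <= S3} by move=> x /JL; rewrite (perm_mem LS).
right; exists r, J; split=> //; first exact: Q_quad.
case: J J0 JS {JL} => // x J _ JS; apply/hasP; exists x; last exact: mem_head.
by apply: JS; apply: mem_head.
Qed.

Lemma TSu_has_leaves (Q : binop k) w : quadratic Q -> rels (b := TSu Q) w -> has_leaves S3 w.
Proof.
move=> Q_quad /(TSu_relP Q_quad)[->|[r [J [_ rL _ _ ->]]]]; first exact: has_leaves0.
exact: has_leaves_TSu.
Qed.

Lemma koszul_quadratic : quadratic (koszul P).
Proof. by move=> r /koszul_has_leaves. Qed.

Lemma TSu_in_koszul w : rels (b := TSu (koszul P)) w ->
  forall I, operadic_ideal I -> (forall g, rels (b := koszul (Tri P)) g -> I g) ->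
  I (map_formal theta id w).
Proof.
move=> /(TSu_relP koszul_quadratic)[->|[r [J [/annihilatorP[_ rR] rL J0 JS ->]]]] I I_id I_rels.
  by rewrite map_formal0; apply: ideal0.
apply: I_rels; apply/annihilatorP; split.
  by apply: has_leaves_map_id; apply: has_leaves_TSu.
exact: TSu_kills_Tri.
Qed.

Lemma theta_inv : exists theta' : dualS2 (TriV V) -> TSuV D,
  [/\ cancel theta theta', cancel theta' theta, linear theta' &
      forall x, theta' (act x) = act (theta' x)].
Proof.
have [theta' thetaK theta'K] := theta_bij V; exists theta'; split=> //.
- by move=> c x y; apply: (can_inj thetaK); rewrite theta_linear !theta'K.
by move=> x; apply: (can_inj thetaK); rewrite theta_act !theta'K.
Qed.

(** The element G assembled from TSu(R^perp) has, after [theta], the same form as f, so their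
    difference is 0 in the free operad; pulling back by [theta'] keeps it in [I]. *)
Lemma koszul_in_TSu f theta' : infinite_field k -> nonzero_rels P ->
  cancel theta theta' -> linear theta' -> (forall x, theta' (act x) = act (theta' x)) ->
  rels (b := koszul (Tri P)) f ->
  forall I, operadic_ideal I -> (forall g, rels (b := TSu (koszul P)) g -> I g) ->
  I (map_formal theta' id f).
Proof.
move=> k_inf [r [Rr r0]] thetaK theta'_lin theta'_act /annihilatorP[fL fR] I I_id I_rels.
have f_free u d x y : u \in S3 -> pform f u (binom x Rgt) (binom y d) =
    pform f u (binom x Rgt) (binom y Lft).
  exact: (free_slot_irrelevant P_quad (pform_bilinear f) fR d x y k_inf Rr r0).
have JsP J : J \in subsets3 -> has (mem J) S3 /\ {subset J <= S3}.
  move=> Js; split.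
    by apply: (allP (_ : all (fun J : seq nat => has (mem J) S3) subsets3)).
  by apply/allP; apply: (allP (_ : all (fun J : seq nat => all (mem S3) J) subsets3)).
have [G [IG GL GE]] := TSu_preimage P_quad (pform_bilinear f) fR f_free I_id I_rels JsP.
have GfL : has_leaves S3 (1 *: map_formal theta id G + (-1) *: f).
  apply: has_leaves_lin; first exact: has_leaves_map_id.
  exact: has_leavesZ.
have Gf0 : free_zero (1 *: map_formal theta id G + (-1) *: f).
  apply: (pform_eq0 GfL) => u X Y uS; apply: form_binom_eq0 (pform_bilinear _) _ X Y => x y s s'.
  rewrite pform_lin -[(-1) *: f]addr0 pform_lin GE // (split_form_sum f_free) //.
  by rewrite {3}/pform lift0 addr0 scale1r scaleN1r subrr.
have := free_zero_in (ideal_preim theta'_lin theta'_act I_id) Gf0.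
have -> := map_formal_linear theta' id 1 (map_formal theta id G) ((-1) *: f).
rewrite map_formal_comp (eq_map_formal _ (h' := id) (s' := id)) //.
rewrite map_formal_id map_formalZ => IGf.
have -> : map_formal theta' id f = G - (1 *: G + (-1) *: map_formal theta' id f).
  by rewrite scale1r scaleN1r opprB addrC subrK.
exact: idealB.
Qed.

(** Elements of R may be nonzero formal sums that represent 0; the elements of Tri(R) are then
    killed by every form, and the annihilator is everything in arity 3. *)
Lemma koszul_Tri_zero f : ~ nonzero_rels P -> has_leaves S3 f -> rels (b := koszul (Tri P)) f.
Proof.
move=> P0 fL; apply/annihilatorP; split=> // s w ps [r [L [J [Rr [uL _] _ _ Tw]]]].
apply: Tri_elt_free_zero uL _ Tw; apply: NNPP => r0.
by apply: P0; exists r.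
Qed.

(* When the root label of the tree [(1 2) 3] is [Rgt], the relations of [TSu(P^!)]
   do not distinguish the inner labels [Lft] and [Rgt]. *)
Definition test_form (x : V) : nat -> TSuV D -> TSuV D -> k^o := fun u F G =>
  if u == 3%N then (F Rgt : 'Hom(V, k^o)) x *
    ((G Lft : 'Hom(V, k^o)) x - (G Rgt : 'Hom(V, k^o)) x) else 0.

Lemma test_form_bilinear x : bilinear_form (test_form x).
Proof.
split=> u F c G H; rewrite /test_form; case: eqP => _; rewrite ?scaler0 ?addr0 //.
  by rewrite !ffunE !add_lfunE !scale_lfunE mulrDl -scalerAl.
by rewrite !ffunE !add_lfunE !scale_lfunE sub_lin mulrDr -scalerAr.
Qed.

(** At type 3 a nonzero [Rgt] component at the root forces J = {3}; the inner decoration is then the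
    sum of the three labels, whose [Lft] and [Rgt] components coincide. *)
Lemma test_form_kills x : kills (test_form x) (rels (b := TSu (koszul P))).
Proof.
move=> s w ps /(TSu_relP koszul_quadratic)[->|[r [J [_ rL J0 JS ->]]]].
  by rewrite /relabel map_formal0 /ev lift0.
rewrite ev_relabel /TSu_elt lift_map lift.unlock big_seq big1 // => t /(rL.2) tS /=.
have sJ : {in leaves t, forall y, (s y \in map s J) = (y \in J)}.
  move=> y; rewrite (perm_mem tS) => yS.
  by apply/mapP/idP => [[z zJ /(perm3_inj ps yS (JS z zJ)) ->]|yJ]; last exists y.
rewrite (TSu_tree_relabel sJ).
have stS : perm_eq (leaves (map_tree id s t)) S3.
  by rewrite leaves_map (perm_trans (perm_map _ tS)).
have sJ0 : has (mem (map s J)) S3.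
  case/hasP: J0 => y yS yJ; apply/hasP; exists (s y); first exact: perm3_in.
  exact: map_f.
have [u [b [b' [phi [psi [uS ->]]]]]] := stdP stS; rewrite evt_TSu // /test_form.
case: eqP => [->|_]; last exact: scaler0.
move: sJ0; rewrite /root_turn /inner_turn /= !orbF.
by case: (1%N \in _); case: (2%N \in _); case: (3%N \in _) => //= _;
  rewrite !ffunE /= ?(addr0, add0r) ?zero_lfunE ?mul0r ?subrr ?mulr0 scaler0.
Qed.
End Main.

Theorem theorem3p5 (k : fieldType) (P : binop k)
  (k_infinite : infinite_field k)
  (P_quadratic : quadratic P)
  (V_nonzero : (0 < \dim (fullv : {vspace (gens P)}))%N) :
  operad_eq (P := TSu (koszul P)) (Q := koszul (Tri P)) (@theta k (gens P))
  <-> nonzero_rels P.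
Proof.
split=> [eq_ops|R_neq0 L f fL]; last first.
  split=> [f_in I I_id I_rels|f_in I I_id I_rels].
    apply: (f_in _ (ideal_preim (@theta_linear _ _) (@theta_act _ _) I_id)) => w Rw.
    exact: TSu_in_koszul.
  (* Pulling the ideal back along the inverse of [theta] reduces the claim to the generating
     relations of the Koszul dual of Tri(P). *)
  have [theta' [thetaK _ theta'_lin theta'_act]] := theta_inv P.
  have := f_in _ (ideal_preim theta'_lin theta'_act I_id).
  rewrite map_formal_comp (eq_map_formal _ (h' := id) (s' := id)) // map_formal_id.
  by apply=> g Rg; apply: koszul_in_TSu I_id I_rels.
apply: NNPP => R0; have e_basis := vbasisP (fullv : {vspace (gens P)}).
set e := vbasis _ in e_basis; pose i : 'I_(\dim {:gens P}) := Ordinal V_nonzero.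
pose phi := dualb e i; pose x := e`_i.
(* A monomial of type 3 that separates the inner labels under the root label [Rgt]: [test_form x]
   takes at it the value phi(x)^2 = 1, with x a basis vector and phi its dual. If R = 0, it lies in
   the annihilator of Tri(R). *)
pose f : {malg k[tree (TSuV (dualS2 (gens P)))]} :=
  tb (std 3 false false (binom phi Rgt) (binom phi Lft)).
have fL : has_leaves S3 f by apply: has_leaves_tb.
have : ideal_gen (rels (b := TSu (koszul P))) f.
  apply/(eq_ops _ _ fL) => I _ I_rels; apply: I_rels; apply: koszul_Tri_zero R0 _.
  exact: has_leaves_map_id.
move/(ideal_gen_ev (test_form_bilinear x)
  (fun r => TSu_has_leaves (@koszul_quadratic _ P)) (test_form_kills x) fL).
rewrite /ev lift_tb evt_std // /test_form !ffunE /= zero_lfunE subr0.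
have -> : (phi : 'Hom(gens P, k^o)) x = 1.
  by rewrite /phi dualbE /x coord_free ?eqxx //; apply: basis_free e_basis.
by move/eqP; rewrite mulr1 oner_eq0.
Qed.
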